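(* Let $\varphi\colon\mathbb{R}_+\to\mathbb{R}_+$ be a map satisfying $\varphi(t)=o\left(t^{1/3}\right)$ as $t\to+\infty$. If $\mathcal{C}$ is a flexible class of rank-one systems, then there exists $T$ in $\mathcal{C}$ which is $\varphi$-integrably orbit equivalent to the universal odometer.
   Context: All probability spaces are standard and atomless. $\mathrm{Aut}(X,\mu)$ is the set of bimeasurable bijections $T$ of $(X,\mathcal{A},\mu)$ preserving the probability measure $\mu$, two such maps being identified if they coincide on a set of full measure. Its elements are called systems or transformations. **Orbit equivalence.** Aperiodic $S\in\mathrm{Aut}(X,\mu)$ and $T\in\mathrm{Aut}(Y,\nu)$ are orbit equivalent if there is a bimeasurable bijection $\Psi\colon X\to Y$ with $\Psi_\star\mu=\nu$ such that $S$ and $\Psi^{-1}T\Psi$ have the same orbits at almost every point. The associated cocycles $c_S\colon X\to\mathbb{Z}$, $c_T\colon Y\to\mathbb{Z}$ are defined almost everywhere by $Sx=\Psi^{-1}T^{c_S(x)}\Psi(x)$ and $Ty=\Psi S^{c_T(y)}\Psi^{-1}(y)$. $S$ and $T$ are $\varphi$-integrably orbit equivalent if some orbit equivalence $\Psi$ satisfies $\int_X\varphi(|c_S|)\,d\mu<+\infty$ and $\int_Y\varphi(|c_T|)\,d\nu<+\infty$. **Universal odometer.** For integers $q_n\ge 2$, the odometer on $\prod_{n\ge0}\{0,\dots,q_n-1\}$ (with the product of the uniform probability measures) is the addition of $(1,0,0,\dots)$ with carry over to the right. It is universal if every prime number has infinite multiplicity as a prime factor among the $q_n$, $n\ge0$.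 The universal odometer is unique up to conjugacy. **Rank-one systems.** A cutting and spacing parameter is a tuple $(q,(\sigma_{\cdot,0},\dots,\sigma_{\cdot,q}))$ with an integer $q\ge2$ and non-negative integers $\sigma_{\cdot,i}$; $\mathcal{P}$ is the set of these, and $\mathcal{P}^*=\bigcup_{n}\mathcal{P}^n$ is the set of finite sequences. For a sequence $(q_n,(\sigma_{n,0},\dots,\sigma_{n,q_n}))_{n\ge0}\in\mathcal{P}^{\mathbb{N}}$ put $\sigma_n=\sum_{i=0}^{q_n}\sigma_{n,i}$, $h_0=1$, $h_{n+1}=q_nh_n+\sigma_n$, and $Z_n=\max\{\sigma_{j,i}\mid 0\le j\le n,\ 0\le i\le q_j\}$; for a finite sequence in $\mathcal{P}^{n+1}$ define $(h_k)_{0\le k\le n+1}$, $(\sigma_k)_{0\le k\le n}$, $(Z_k)_{0\le k\le n}$ by the same formulas. Condition (F) is: $\sum_{n\ge0}\sigma_n/h_{n+1}<+\infty$. A transformation $T\in\mathrm{Aut}(X,\mu)$ is of rank one if there are a sequence in $\mathcal{P}^{\mathbb{N}}$ satisfying (F) and measurable sets $B_n$, $B_{n,i}$ ($0\le i\le q_n-1$), $\Sigma_{n,i,j}$ ($0\le i\le q_n$, $1\le j\le\sigma_{n,i}$) such that for all $n\ge0$: (a) $B_n,T(B_n),\dots,T^{h_n-1}(B_n)$ are pairwise disjoint; (b) $(B_{n,0},\dots,B_{n,q_n-1})$ is a partition of $B_n$; (c) $T^{h_n}(B_{n,i})=\Sigma_{n,i+1,1}$ if $\sigma_{n,i+1}>0$,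 and $T^{h_n}(B_{n,i})=B_{n,i+1}$ if $\sigma_{n,i+1}=0$ and $i<q_n-1$; (d) if $\sigma_{n,i}>0$, then $T(\Sigma_{n,i,j})=\Sigma_{n,i,j+1}$ if $j<\sigma_{n,i}$, and $T(\Sigma_{n,i,j})=B_{n,i}$ if $j=\sigma_{n,i}$ and $i\le q_n-1$; (e) $B_{n+1}=\Sigma_{n,0,1}$ if $\sigma_{n,0}>0$, and $B_{n+1}=B_{n,0}$ if $\sigma_{n,0}=0$; and moreover $\{T^k(B_n)\mid n\ge0,\ 0\le k\le h_n-1\}$ generates $\mathcal{A}$ up to null sets. These data are called a cutting-and-stacking construction of $T$ with the given parameters. Every sequence in $\mathcal{P}^{\mathbb{N}}$ satisfying (F) is the parameter sequence of a rank-one system, unique up to conjugacy: its underlying rank-one system. Classes of systems are understood up to conjugacy. A construction is CSP with constant $C>0$ if $Z_n\le Ch_n$ for all $n$. **Flexible classes.** A class $\mathcal{C}$ of rank-one systems is flexible if there is a subset $\mathcal{F}_{\mathcal{C}}\subseteq\mathcal{P}^*$ such that: 1. there is a constant $C>0$ such that for every $(q_n,(\sigma_{n,0},\dots,\sigma_{n,q_n}))_{n\ge0}\in\mathcal{P}^{\mathbb{N}}$ satisfying (F), if $(q_k,(\sigma_{k,0},\dots,\sigma_{k,q_k}))_{0\le k\le n}\in\mathcal{F}_{\mathcal{C}}$ for every $n\ge0$, then these parameters define a CSP construction with constant $C$ and the underlying rank-one system is in $\mathcal{C}$; 2. there is a cutting and spacing parameter $(q_0,(\sigma_{0,0},\dots,\sigma_{0,q_0}))$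 in $\mathcal{F}_{\mathcal{C}}$ with $q_0\ge3$; 3. there is a constant $C'>0$ such that for all $n\ge1$, if $(q_k,(\sigma_{k,0},\dots,\sigma_{k,q_k}))_{0\le k\le n-1}$ is in $\mathcal{F}_{\mathcal{C}}$, then there are infinitely many integers $q_n$ such that $(q_k,(\sigma_{k,0},\dots,\sigma_{k,q_k}))_{0\le k\le n}$ is in $\mathcal{F}_{\mathcal{C}}$ for some $\sigma_{n,0},\dots,\sigma_{n,q_n}$ satisfying $\sigma_n\le C'q_nh_{n-1}$. *)

(* Defs.v *)
From HB Require Import structures.
From mathcomp Require Import all_boot all_order all_algebra.
From mathcomp Require Import all_classical all_reals all_analysis.

Set Implicit Arguments.
Unset Strict Implicit.
Unset Printing Implicit Defensive.

Import Order.TTheory GRing.Theory Num.Theory.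
Import numFieldNormedType.Exports.

Local Open Scope classical_set_scope.
Local Open Scope ring_scope.

(* The Landau notations of the library expect a canonical [filter_on]. *)
Canonical pinfty_filter_on (R : realType) := FilterType (pinfty_nbhs R) _.

(** * Standard atomless probability spaces *)

(* A measurable space is standard Borel when it is isomorphic to a Borel subset
   of a Polish space; a Hausdorff complete pseudometric space is the same thing
   as a complete metric space. Taking A = setT shows that the image of f is
   Borel. *)
Definition standard_borel (R : realType) d (X : measurableType d) : Prop :=
  exists (P : completePseudoMetricType R) (f : X -> P),
    [/\ hausdorff_space P,
        exists D : set P, countable D /\ dense D,
        injective f &
        forall A : set X, measurable A <-> <<s @open P >> (f @` A)].

Definition atomless (R : realType) d (X : measurableType d)
    (mu : probability X R) : Prop :=
  forall A : set X, measurable A -> (0 < mu A)%E ->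
    exists B : set X,
      [/\ measurable B, B `<=` A, (0 < mu B)%E & (mu B < mu A)%E].

(** * Transformations and systems *)

Record mp_iso (R : realType) dX dY (X : measurableType dX)
    (Y : measurableType dY) (mu : probability X R) (nu : probability Y R) :=
  MpIso {
    mp_fun :> X -> Y ;
    mp_inv : Y -> X ;
    mp_funK : cancel mp_fun mp_inv ;
    mp_invK : cancel mp_inv mp_fun ;
    mp_fun_measurable : measurable_fun setT mp_fun ;
    mp_inv_measurable : measurable_fun setT mp_inv ;
    mp_fun_pushforward : forall B : set Y, measurable B ->
      mu (mp_fun @^-1` B) = nu B
  }.

(* Elements of Aut(X, mu) are given by everywhere defined representatives; the
   identification of maps that agree almost everywhere is part of the relation
   [conjugate] below (take for Psi the identity). *)
Definition aut (R : realType) d (X : measurableType d) (mu : probability X R) :=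
  mp_iso mu mu.

Definition zpow (R : realType) d (X : measurableType d)
    (mu : probability X R) (T : aut mu) (k : int) : X -> X :=
  match k with
  | Posz n => iter n T
  | Negz n => iter n.+1 (mp_inv T)
  end.

Definition conjugate (R : realType) dX dY (X : measurableType dX)
    (Y : measurableType dY) (mu : probability X R) (nu : probability Y R)
    (S : aut mu) (T : aut nu) : Prop :=
  exists Psi : mp_iso mu nu, {ae mu, forall x, Psi (S x) = T (Psi x)}.

Record system (R : realType) := System {
  sys_display : measure_display ;
  sys_space : measurableType sys_display ;
  sys_mu : probability sys_space R ;
  sys_standard : standard_borel R sys_space ;
  sys_atomless : atomless sys_mu ;
  sys_map :> aut sys_mu
}.

(** * Integrable orbit equivalence *)

Definition aperiodic (R : realType) d (X : measurableType d)
    (mu : probability X R) (T : aut mu) : Prop :=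
  {ae mu, forall x, forall n, (0 < n)%N -> iter n T x <> x}.

Definition same_orbits (R : realType) dX dY (X : measurableType dX)
    (Y : measurableType dY) (mu : probability X R) (nu : probability Y R)
    (S : aut mu) (T : aut nu) (Psi : mp_iso mu nu) : Prop :=
  {ae mu, forall x, range (fun k => zpow S k x) =
                    range (fun k => mp_inv Psi (zpow T k (Psi x)))}.

(* For aperiodic S and T the cocycles are unique up to null sets. *)
Definition cocycles (R : realType) dX dY (X : measurableType dX)
    (Y : measurableType dY) (mu : probability X R) (nu : probability Y R)
    (S : aut mu) (T : aut nu) (Psi : mp_iso mu nu)
    (cS : X -> int) (cT : Y -> int) : Prop :=
  [/\ forall k, measurable (cS @^-1` [set k]),
      forall k, measurable (cT @^-1` [set k]),
      {ae mu, forall x, S x = mp_inv Psi (zpow T (cS x) (Psi x))} &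
      {ae nu, forall y, T y = Psi (zpow S (cT y) (mp_inv Psi y))}].

Definition integrably_orbit_equivalent (R : realType) (phi : R -> R)
    dX dY (X : measurableType dX) (Y : measurableType dY)
    (mu : probability X R) (nu : probability Y R)
    (S : aut mu) (T : aut nu) : Prop :=
  [/\ aperiodic S, aperiodic T &
      exists Psi : mp_iso mu nu, same_orbits S T Psi /\
      exists cS cT, [/\ cocycles S T Psi cS cT,
        (\int[mu]_x (phi (absz (cS x))%:R)%:E < +oo)%E &
        (\int[nu]_y (phi (absz (cT y))%:R)%:E < +oo)%E]].

(** * The universal odometer *)

HB.instance Definition _ (n : nat) := isPointed.Build 'I_n.+2 ord0.

(* A sequence of integers q_n >= 2 is encoded by r with q_n = (r n).+2. *)
Definition digits (r : nat -> nat) : pointedType := forall n, 'I_(r n).+2.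

Definition digit_sets (r : nat -> nat) : set (set (digits r)) :=
  [set A | exists n a, A = [set x | x n = a]].

Definition odometer_space (r : nat -> nat) :=
  g_sigma_algebraType (@digit_sets r).

Definition product_of_uniforms (R : realType) (r : nat -> nat)
    (P : set (odometer_space r) -> \bar R) : Prop :=
  forall (n : nat) (a : odometer_space r),
    P [set x | forall i, (i < n)%N -> x i = a i] =
    (\prod_(i < n) ((r i).+2%:R)^-1)%:E.

(* ordS adds 1 to a digit modulo q_n; the carry reaches position n exactly when
   all earlier digits are maximal. *)
Definition add_with_carry (r : nat -> nat) (x : odometer_space r) :
    odometer_space r :=
  fun n => if [forall i : 'I_n, x i == ord_max] then ordS (x n) else x n.

Definition universal_radices (r : nat -> nat) : Prop :=
  forall p M, prime p -> exists N, (M <= \sum_(n < N) logn p (r n).+2)%N.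

(* Being the universal odometer is understood up to conjugacy. *)
Definition universal_odometer (R : realType) d (Y : measurableType d)
    (nu : probability Y R) (U : aut nu) : Prop :=
  exists (r : nat -> nat) (P : probability (odometer_space r) R) (V : aut P),
    [/\ universal_radices r, product_of_uniforms P,
        forall x, V x = add_with_carry x & conjugate U V].

(** * Rank-one systems *)

(* (q, (sigma_{.,0}, ..., sigma_{.,q})) *)
Record csparam := CsParam {
  cuts : nat ;
  cuts_ge2 : (2 <= cuts)%N ;
  spacers : cuts.+1.-tuple nat
}.

Definition spacer (p : csparam) (i : nat) : nat := nth 0%N (spacers p) i.

Definition spacer_sum (p : csparam) : nat :=
  (\sum_(i < (cuts p).+1) spacer p i)%N.

Fixpoint height (w : nat -> csparam) (n : nat) : nat :=
  match n with
  | 0 => 1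
  | m.+1 => cuts (w m) * height w m + spacer_sum (w m)
  end%N.

Definition csparam0 : csparam := CsParam (leqnn 2) [tuple of nseq 3 0%N].

(* The height h_k of a finite sequence s, for k <= size s; it only depends on
   the first k entries of s, so csparam0 is irrelevant. *)
Definition seq_height (s : seq csparam) (k : nat) : nat :=
  height (nth csparam0 s) k.

Definition max_spacer (w : nat -> csparam) (n : nat) : nat :=
  (\max_(j < n.+1) \max_(i < (cuts (w j)).+1) spacer (w j) i)%N.

Definition condF (R : realType) (w : nat -> csparam) : Prop :=
  (\sum_(0 <= n <oo)
     ((spacer_sum (w n))%:R / (height w n.+1)%:R : R)%:E < +oo)%E.

Definition CSP (R : realType) (C : R) (w : nat -> csparam) : Prop :=
  forall n, (max_spacer w n)%:R <= C * (height w n)%:R.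

(* B n, Bi n i and Sig n i j are the sets B_n, B_{n,i} and Sigma_{n,i,j}; only
   the indices i < q_n for Bi, and i <= q_n, 1 <= j <= sigma_{n,i} for Sig, are
   constrained. *)
Record cutting_stacking (R : realType) d (X : measurableType d)
    (mu : probability X R) (T : aut mu) (w : nat -> csparam)
    (B : nat -> set X) (Bi : nat -> nat -> set X)
    (Sig : nat -> nat -> nat -> set X) : Prop := {
  cs_measurableB : forall n, measurable (B n) ;
  cs_measurableBi : forall n i, (i < cuts (w n))%N -> measurable (Bi n i) ;
  cs_measurableSig : forall n i j, (i <= cuts (w n))%N ->
    (1 <= j <= spacer (w n) i)%N -> measurable (Sig n i j) ;
  cs_tower : forall n,
    trivIset `I_(height w n) (fun k => iter k T @` B n) ;
  cs_cover : forall n, \bigcup_(i in `I_(cuts (w n))) Bi n i = B n ;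
  cs_disjoint : forall n, trivIset `I_(cuts (w n)) (Bi n) ;
  cs_top_spacer : forall n i, (i < cuts (w n))%N ->
    (0 < spacer (w n) i.+1)%N ->
    iter (height w n) T @` Bi n i = Sig n i.+1 1%N ;
  cs_top_next : forall n i, (i < (cuts (w n)).-1)%N ->
    spacer (w n) i.+1 = 0%N ->
    iter (height w n) T @` Bi n i = Bi n i.+1 ;
  cs_spacer_next : forall n i j, (i <= cuts (w n))%N ->
    (1 <= j < spacer (w n) i)%N ->
    T @` Sig n i j = Sig n i j.+1 ;
  cs_spacer_base : forall n i, (i < cuts (w n))%N ->
    (0 < spacer (w n) i)%N ->
    T @` Sig n i (spacer (w n) i) = Bi n i ;
  cs_base_spacer : forall n, (0 < spacer (w n) 0)%N -> B n.+1 = Sig n 0%N 1%N ;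
  cs_base_cut : forall n, spacer (w n) 0 = 0%N -> B n.+1 = Bi n 0%N ;
  cs_generating : forall A, measurable A ->
    exists A', <<s [set L | exists n k, (k < height w n)%N /\
                              L = iter k T @` B n] >> A' /\
               mu.-negligible (A `+` A')
}.

Definition has_construction (R : realType) (T : system R)
    (w : nat -> csparam) : Prop :=
  exists B Bi Sig, @cutting_stacking _ _ _ _ T w B Bi Sig.

Definition rank_one (R : realType) (T : system R) : Prop :=
  exists w, condF R w /\ has_construction T w.

(* Classes of systems are understood up to conjugacy. *)
Definition rank_one_class (R : realType) (C : system R -> Prop) : Prop :=
  (forall T, C T -> rank_one T) /\
  (forall S T : system R, conjugate S T -> C S -> C T).

(** * Flexible classes *)

(* In the first condition, the underlying rank-one system of w is unique up to
   conjugacy, and C is closed under conjugacy. In the third one, s stands for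
   the parameters of indices 0, ..., n-1, so n = size s. *)
Definition flexible (R : realType) (C : system R -> Prop) : Prop :=
  exists F : set (seq csparam),
  [/\ exists2 K : R, 0 < K &
        forall w : nat -> csparam, condF R w ->
          (forall n, F (mkseq w n.+1)) ->
          CSP K w /\ (forall T : system R, has_construction T w -> C T),
      exists p, F [:: p] /\ (3 <= cuts p)%N &
      exists2 K' : R, 0 < K' &
        forall s : seq csparam, (1 <= size s)%N -> F s ->
          infinite_set [set q : nat | exists p,
            [/\ cuts p = q, F (rcons s p) &
                (spacer_sum p)%:R <=
                  K' * q%:R * (seq_height s (size s).-1)%:R]]].

(* Main.v *)
(** The rank-one transformation T is realised on the space of the odometer V,
    with the same orbits as V outside a null set.  At stage n, V has a tower
    with H_n levels and T a tower with h_n > H_n levels, and an injection c_n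
    from [0, H_n) to [0, h_n) tells which level of the T-tower is the k-th
    level of the V-tower.  The next T-tower consists of q_n copies of the
    current one and of spacers.  Its levels that are not images under c_n
    inside a copy are grouped, H_n by H_n and in increasing order, into
    additional V-towers; the copies and the additional towers are interleaved
    so that c_(n+1) is at distance O(n h_n^2) of the identity.  Stopping when
    the number of V-towers is a multiple of n + 1 makes the odometer universal
    and leaves at most (n + 1) H_n levels unused.  Only a proportion
    O(n h_(n-1) / h_n) of the points have a successor (for T or for V) that is
    decided at stage n + 1 and not before, and for these points the cocycles
    are O(n h_n^2).  The numbers of cuts are taken so large that
    sum_n n h_(n-1) / h_n * (n h_n^2)^(1/3) converges. *)

From HB Require Import structures.
Require Import Defs.
From mathcomp Require Import all_boot all_order all_algebra.
From mathcomp Require Import all_classical all_reals all_analysis.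
From mathcomp Require Import measurable_realfun zify ring lra.

Set Implicit Arguments.
Unset Strict Implicit.
Unset Printing Implicit Defensive.

Import Order.TTheory GRing.Theory Num.Theory.
Import numFieldNormedType.Exports.

(** * Interleaving the copies of a tower with additional towers *)

(** The class dictates the spacers; the only freedom is to take the numbers of cuts large. The
    strict inequality H_n < h_n is what keeps the induction alive: every copy then brings at least
    one leftover level, and for large q_n this is enough to fit all q_n copies of the V-tower below
    h_(n+1), in spite of the rounding. It starts with H_1 = 2 < 3 <= q_0 <= h_1. The same inequality
    explains the square in h_n^2. If a copy brings just one leftover, about H_n copies are needed to
    fill one additional V-tower, and the H_n^2 used levels of these copies measure its displacement.
    A level of the T-tower missed by c_n receives its points at later stages only. So c_n locates a
    point once all its digits from n on stand for copies, which by Borel-Cantelli happens almost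
    surely for n large; from then on differences of levels no longer depend on the stage. The
    condition on the spacers makes their proportion O(h_(n-1) / h_n), comparable with the rounding
    loss. The general term of the final series is then about n^(4/3) h_(n-1) / h_n^(1/3), and h_n >=
    q_(n-1) makes it small when q_(n-1) dominates the cube of h_(n-1). *)

Lemma index_filter_iota (a : pred nat) N x : x < N -> a x ->
  index x [seq y <- iota 0 N | a y] = count a (iota 0 x).
Proof.
move=> xN ax; rewrite -(subnKC (ltnW xN)) iotaD add0n filter_cat index_cat.
rewrite mem_filter mem_iota /= ltnn andbF -size_filter.
have /prednK <- : 0 < N - x by rewrite subn_gt0.
by rewrite /= ax /= eqxx addn0.
Qed.

Lemma count_iota_image (a : pred nat) N (s : seq nat) : uniq s ->
  (forall x, (x \in s) = a x && (x < N)) -> count a (iota 0 N) = size s.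
Proof.
move=> us sE; rewrite -size_filter; apply/perm_size/uniq_perm => //.
  by rewrite filter_uniq ?iota_uniq.
by move=> x; rewrite mem_filter mem_iota sE.
Qed.

Lemma count_iotaC (a : pred nat) N :
  count (fun x => ~~ a x) (iota 0 N) = N - count a (iota 0 N).
Proof.
by rewrite -[X in X - _](size_iota 0) -(count_predC a (iota 0 N)) addKn.
Qed.

(* Position of the first level of the i-th copy of a tower of height h in the
   next tower; i = q gives the height of the next tower. *)
Definition copy_offset (h : nat) (s : nat -> nat) (i : nat) : nat :=
  i * h + \sum_(l < i.+1) s l.

Section CopyOffset.
Variables (h : nat) (s : nat -> nat).
Local Notation o := (copy_offset h s).

Lemma copy_offset0 : o 0 = s 0.
Proof. by rewrite /copy_offset mul0n big_ord1. Qed.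

Lemma copy_offsetS i : o i.+1 = o i + h + s i.+1.
Proof. by rewrite /copy_offset big_ord_recr /= mulSn; lia. Qed.

Lemma copy_offset_mono i j : i <= j -> o i + (j - i) * h <= o j.
Proof.
move=> /subnKC <-; rewrite addKn; elim: (j - i) => [|d IH]; first by rewrite !addn0.
by rewrite addnS copy_offsetS mulSn; lia.
Qed.

Lemma copy_offset_le i j : i <= j -> o i <= o j.
Proof. by move=> ij; apply: leq_trans (copy_offset_mono ij); apply: leq_addr. Qed.

Lemma copy_offset_inj i j k k' : k < h -> k' < h -> o i + k = o j + k' -> i = j.
Proof.
move=> kh k'h E; have [ij|ij|//] := ltngtP i j.
- by have := copy_offset_le ij; rewrite copy_offsetS; lia.
- by have := copy_offset_le ij; rewrite copy_offsetS; lia.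
Qed.

End CopyOffset.

(* Here H and h are the heights H_n and h_n, p * H is H_(n+1), e is c_n, and
   the spacers are s 0, ..., s q.  At most N * H levels will stay unused. *)
Record filling (h H q p N : nat) (s e : nat -> nat) : Prop := Filling {
  filling_gt0 : 0 < H ;
  filling_height : H < h ;
  filling_cuts : q <= p ;
  filling_lt : forall k, k < H -> e k < h ;
  filling_inj : forall k k', k < H -> k' < H -> e k = e k' -> k = k' ;
  filling_upper : p * H < copy_offset h s q ;
  filling_lower : copy_offset h s q <= (p + N) * H }.

Section Step.
Variables (h H q p N : nat) (s e : nat -> nat).
Hypothesis fillP : filling h H q p N s e.
Let H_gt0 := filling_gt0 fillP.
Let H_lt := filling_height fillP.
Let q_le := filling_cuts fillP.
Let e_lt := filling_lt fillP.
Let e_inj := filling_inj fillP.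
Let fill_lt := filling_upper fillP.
Let fill_ge := filling_lower fillP.
Let o := copy_offset h s.

Let o_step i : o i + h <= o i.+1. Proof. by rewrite /o copy_offsetS leq_addr. Qed.
Let o_mono i j : i <= j -> o i + (j - i) * h <= o j. Proof. exact:
  copy_offset_mono. Qed.
Let o_le i j : i <= j -> o i <= o j. Proof. exact: copy_offset_le. Qed.
Let o_inj i j k k' : k < h -> k' < h -> o i + k = o j + k' -> i = j.
Proof. exact: copy_offset_inj. Qed.

Let pairs i := [seq o a + e k | a <- iota 0 i, k <- iota 0 H].
Let used x := x \in pairs q.

Let pairsP i x :
  reflect (exists a k, [/\ a < i, k < H & x = o a + e k]) (x \in pairs i).
Proof.
apply: (iffP allpairsP) => [[[a k] /= []]|[a [k [ai kH ->]]]].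
  by rewrite !mem_iota => /= ai kH ->; exists a, k.
by exists (a, k); rewrite !mem_iota.
Qed.

Let pairs_uniq i : uniq (pairs i).
Proof.
apply: allpairs_uniq; rewrite ?iota_uniq // => -[a k] [a' k'].
move=> /allpairsP[[u v] /= [ui vH [-> ->]]] /allpairsP[[u' v'] /= [ui' vH' [->
  ->]]].
move: vH vH'; rewrite !mem_iota !add0n /= => vH vH' E.
have uu' : u = u' by apply: o_inj E; apply: e_lt.
by subst u'; congr pair; apply: e_inj => //; lia.
Qed.

Let size_pairs i : size (pairs i) = i * H.
Proof. by rewrite size_allpairs !size_iota. Qed.

Let U x := count used (iota 0 x).

Let U_o i : i <= q -> U (o i) = i * H.
Proof.
move=> iq; rewrite /U -size_pairs; apply: count_iota_image => // x.
apply/pairsP/andP => [[a [k [ai kH ->]]]|[/pairsP[a [k [aq kH ->]]] lt]].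
  split; first by apply/pairsP; exists a, k; split=> //; lia.
  by have := o_le ai; have := o_step a; have := e_lt kH; lia.
exists a, k; split=> //; rewrite ltnNge; apply/negP => ia.
by have := o_le ia; lia.
Qed.

Let U_mono x y : x <= y -> U x <= U y /\ U y - U x <= y - x.
Proof.
move=> /subnKC <-; rewrite /U iotaD count_cat; split; first by lia.
have := count_size used (iota (0 + x) (y - x)); rewrite size_iota.
lia.
Qed.

Let U_le x : U x <= x.
Proof. by have := count_size used (iota 0 x); rewrite size_iota. Qed.

(** These are the spacers as well as the levels of each copy missed by [e]; both kinds are recycled
    without distinction. *)
Let leftovers := [seq x <- iota 0 (o q) | ~~ used x].

Let size_leftovers : size leftovers = o q - q * H.
Proof.
by rewrite size_filter -(U_o (leqnn q)) count_iotaC.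
Qed.

(** Below the leftover of rank [t] lie [t] leftovers and otherwise only used levels. This identity
    turns the displacement of an additional level into a count of used levels. *)
Let leftover_spec t : t < size leftovers ->
  let x := nth 0 leftovers t in [/\ x < o q, ~~ used x & x = t + U x].
Proof.
move=> tl x; have : x \in leftovers by apply: mem_nth.
rewrite mem_filter mem_iota => /andP[ux /= xo]; split=> //.
have ul : uniq leftovers by rewrite filter_uniq ?iota_uniq.
have := index_uniq 0 tl ul; rewrite -/x /leftovers index_filter_iota // => <-.
by rewrite count_iotaC subnK ?U_le.
Qed.

Let f i := minn (p - q) ((o i - i * H) %/ H).
(* The V-towers inside the next one are numbered by units 0, ..., p - 1. Before
   the i-th copy there are o i - i * H leftover levels, which fill
   (o i - i * H) %/ H additional V-towers, as long as these are not exhausted. *)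
Definition copy_unit i :=
  i + minn (p - q) ((copy_offset h s i - i * H) %/ H).

Let o_ge i : i * H <= o i.
Proof. by have := o_mono (leq0n i); nia. Qed.

(** Since [H < h], every copy brings at least one leftover. This weak rate is all that is known, and
    it costs the factor [H] in [refine_near]. *)
Let o_left i j : i <= j -> o i - i * H + (j - i) <= o j - j * H.
Proof. by move=> ij; have := o_mono ij; have := o_ge i; have := o_ge j; nia. Qed.

Let f_mono i j : i <= j -> f i <= f j.
Proof.
move=> ij; rewrite /f; have : (o i - i * H) %/ H <= (o j - j * H) %/ H.
  by apply: leq_div2r; have := o_left ij; lia.
lia.
Qed.

Let f_le i : f i <= p - q. Proof. exact: geq_minl. Qed.

Lemma copy_unit_mono i j : i < j -> copy_unit i < copy_unit j.
Proof. by move=> ij; have := f_mono (ltnW ij); rewrite /copy_unit /f /o; lia. Qed.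

Lemma copy_unit_inj i j : copy_unit i = copy_unit j -> i = j.
Proof.
by have [ij|ij|//] := ltngtP i j; have := copy_unit_mono ij; lia.
Qed.

Lemma copy_unit_lt i : i < q -> copy_unit i < p.
Proof. by have := f_le i; rewrite /copy_unit /f /o; lia. Qed.

Let copies := [seq copy_unit i | i <- iota 0 q].
Let copiesP u : reflect (exists2 i, i < q & u = copy_unit i) (u \in copies).
Proof.
apply: (iffP mapP) => [[i]|[i iq ->]]; last by exists i; rewrite // mem_iota.
by rewrite mem_iota => /= iq ->; exists i.
Qed.

Let split_copies u : u \notin copies -> exists2 i0, i0 <= q &
  (forall i, i < i0 -> copy_unit i < u) /\
  (forall i, i0 <= i < q -> u < copy_unit i).
Proof.
move=> uc; have : forall i, i < q -> copy_unit i <> u.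
  by move=> i iq E; case/copiesP: uc; exists i.
elim: q => [|q' IH] ne; first by exists 0; split=> // i; lia.
have [i|i0 i0q [lo hi]] := IH; first by move=> iq; apply: ne; lia.
have [lt|gt|E] := ltngtP (copy_unit q') u.
- exists q'.+1 => //; split=> [i iq|i]; last by lia.
  have [->//|ne'] := eqVneq i q'.
  by apply: ltn_trans lt; apply: copy_unit_mono; lia.
- exists i0; first by lia.
  split=> // i /andP[i0i]; rewrite ltnS leq_eqVlt => /predU1P[->//|iq].
  by apply: hi; rewrite i0i.
- by case: (ne q' _ E).
Qed.

Let extras := [seq u <- iota 0 p | u \notin copies].

Let copies_uniq : uniq copies.
Proof. by rewrite map_inj_uniq ?iota_uniq //; exact: copy_unit_inj. Qed.

Let size_extras : size extras = p - q.
Proof.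
rewrite size_filter count_iotaC (@count_iota_image _ _ copies) //.
  by rewrite size_map size_iota.
move=> x; apply/idP/andP => [xc|[]//]; split=> //.
by case/copiesP: xc => i iq ->; apply: copy_unit_lt.
Qed.

(** Here [i0] is the number of copies placed before the unit [u]. Comparing [u] with the copies just
    before and just after it tells how many additional units could be filled at these two
    moments. *)
Let extra_spec u : u \in extras -> exists2 i0, i0 <= q &
  [/\ u = index u extras + i0, i0 = 0 \/ f i0.-1 <= index u extras &
      i0 = q \/ index u extras < f i0].
Proof.
rewrite mem_filter mem_iota /= add0n => /andP[uc up].
have [i0 i0q [lo hi]] := split_copies uc; exists i0 => //.
have cnt : count (fun x => x \in copies) (iota 0 u) = i0.
  rewrite (@count_iota_image _ _ [seq copy_unit i | i <- iota 0 i0]).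
  - by rewrite size_map size_iota.
  - by rewrite map_inj_uniq ?iota_uniq //; exact: copy_unit_inj.
  - move=> x; apply/mapP/andP => [[i]|[/copiesP[i iq ->] xu]].
      rewrite mem_iota /= add0n => ii0 ->; split; last exact: lo.
      by apply/copiesP; exists i => //; lia.
    exists i => //; rewrite mem_iota /= add0n ltnNge; apply/negP => i0i.
    by have := hi i; rewrite i0i iq => /(_ isT); lia.
have idx : index u extras = u - i0.
  by rewrite index_filter_iota // count_iotaC cnt.
have i0u : i0 <= u by rewrite -cnt -[leqRHS](size_iota 0 u) count_size.
split; first by lia.
- case: i0 lo {hi i0q cnt i0u} idx => [|i] lo ->; [by left|right].
  by have := lo i (leqnn _); rewrite /copy_unit /f /o /=; lia.
- have [iq|iq] := ltnP i0 q; [right|by left; lia].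
  by have := hi i0; rewrite leqnn iq => /(_ isT); rewrite idx /copy_unit /f /o; lia.
Qed.

Definition refine y : nat :=
  let u := y %/ H in let k := y %% H in
  if u \in copies then o (index u copies) + e k
  else nth 0 leftovers (index u extras * H + k).

Lemma refine_copy i k : i < q -> k < H ->
  refine (copy_unit i * H + k) = copy_offset h s i + e k.
Proof.
move=> iq kH; rewrite /refine divnMDl // (divn_small kH) addn0 modnMDl
  modn_small //.
have ic : copy_unit i \in copies by apply/copiesP; exists i.
rewrite ic; congr (o _ + _).
rewrite index_map; last exact: copy_unit_inj.
have := @index_uniq _ 0 i (iota 0 q); rewrite size_iota nth_iota // add0n.
by apply; rewrite ?iota_uniq.
Qed.

Let extra_lt u k : u \in extras -> k < H ->
  index u extras * H + k < size leftovers.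
Proof.
move=> ue kH; have : index u extras < p - q by rewrite -size_extras index_mem.
by rewrite size_leftovers; move: fill_lt; rewrite -/(o q); nia.
Qed.

Let unit_cases y : y < p * H ->
  (exists i, [/\ i < q, y %/ H = copy_unit i & refine y = o i + e (y %% H)]) \/
  (y %/ H \in extras /\
   refine y = nth 0 leftovers (index (y %/ H) extras * H + y %% H)).
Proof.
move=> yp; have up : y %/ H < p by rewrite ltn_divLR.
case: (boolP (y %/ H \in copies)) => [/copiesP[i iq E]|uc].
  left; exists i; split=> //; rewrite {1}(divn_eq y H) E refine_copy //.
  by rewrite ltn_mod.
right; split; last by rewrite /refine (negbTE uc).
by rewrite mem_filter uc mem_iota.
Qed.

Lemma refine_lt y : y < p * H -> refine y < copy_offset h s q.
Proof.
have kH : y %% H < H by rewrite ltn_mod.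
case/unit_cases => [[i [iq _ ->]]|[ue ->]].
  by have := o_le iq; have := o_step i; have := e_lt kH; rewrite -/(o q); lia.
by have [] := leftover_spec (extra_lt ue kH).
Qed.

Lemma refine_inj y y' :
  y < p * H -> y' < p * H -> refine y = refine y' -> y = y'.
Proof.
have kH : y %% H < H by rewrite ltn_mod.
have kH' : y' %% H < H by rewrite ltn_mod.
have ul : uniq leftovers by rewrite filter_uniq ?iota_uniq.
move=> /unit_cases[[i [iq u ->]]|[ue ->]] /unit_cases[[i' [iq' u' ->]]|[ue' ->]] E.
- have ii' : i = i' by apply: o_inj E; apply: e_lt.
  subst i'; have kk' : y %% H = y' %% H by apply: e_inj => //; lia.
  by rewrite (divn_eq y H) (divn_eq y' H) u u' kk'.
- have [_ /negP[]] := leftover_spec (extra_lt ue' kH'); rewrite -E.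
  by apply/pairsP; exists i, (y %% H).
- have [_ /negP[]] := leftover_spec (extra_lt ue kH); rewrite E.
  by apply/pairsP; exists i', (y' %% H).
- move/eqP: E; rewrite nth_uniq ?extra_lt // => /eqP E.
  have mm : index (y %/ H) extras = index (y' %/ H) extras by nia.
  have kk : y %% H = y' %% H by nia.
  rewrite (divn_eq y H) (divn_eq y' H) kk.
  by rewrite -(nth_index 0 ue) mm nth_index.
Qed.

(** For a copy, the displacement comes from the leftovers before it that are not yet grouped (fewer
    than [H], or at most [N * H] once the additional units are exhausted) and from [e] itself, at
    most [h]. For an additional unit preceded by [i0] copies it equals [U x - i0 * H], which is
    shown to lie between [- (H + 1) * H] and 0. *)
Lemma refine_near y : y < p * H ->
  refine y <= y + (h + (H + N + 2) * H) /\ y <= refine y + (h + (H + N + 2) * H).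
Proof.
have kH : y %% H < H by rewrite ltn_mod.
set k := y %% H in kH *; have yE : y = y %/ H * H + k := divn_eq y H.
move=> /unit_cases[[i [iq u ->]]|[ue ->]]; rewrite -/k.
  have ek := e_lt kH.
  have oi := o_ge i; have oq := o_left (ltnW iq).
  have [d1 d2] : (o i - i * H) %/ H * H <= o i - i * H /\
      o i - i * H < (o i - i * H) %/ H * H + H.
    have := divn_eq (o i - i * H) H; have := ltn_pmod (o i - i * H) H_gt0; lia.
  have oqq : o q - q * H <= (p - q + N) * H by rewrite /o; nia.
  have uE : y %/ H = i + f i by [].
  have fl : f i * H <= o i - i * H by rewrite /f; nia.
  have fg : o i - i * H <= f i * H + N * H + H.
    by rewrite /f /minn; case: ifP => _; move: oqq; rewrite !mulnDl; lia.
  by rewrite yE uE !mulnDl; lia.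
set m := index _ _; set x := nth _ _ _.
have [xo xu xE] := leftover_spec (extra_lt ue kH).
rewrite -/m -/x in xo xu xE.
have mp : m < p - q by rewrite -size_extras index_mem.
have [i0 i0q [uE lo hi]] := extra_spec ue; rewrite -/m in uE lo hi.
have up : U x <= i0 * H.
  have [->|i0q'] := eqVneq i0 q.
    by rewrite -U_o //; have [] := U_mono (ltnW xo).
  have {}hi : m < f i0 by case: hi i0q' => [->|//]; rewrite eqxx.
  have ox : x <= o i0.
    rewrite leqNgt; apply/negP => ox; have [_] := U_mono (ltnW ox).
    rewrite U_o // => Ux.
    have : m < (o i0 - i0 * H) %/ H by move: hi; rewrite /f; lia.
    rewrite leq_divRL // mulSn => mo.
    by move: xE; have := U_le x; have := o_ge i0; lia.
  by rewrite -U_o //; have [] := U_mono ox.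
have dn : i0 * H <= U x + (H + 1) * H.
  case: lo => [->//|lo].
  (* The [H] copies from [j] on bring at least [H] leftovers, so fewer than [m * H] leftovers lie
     below [o j]; hence all copies before [j] are below [x]. *)
  have [small|big] := leqP i0 (H + 1).
    by apply: leq_trans (leq_addl _ _); rewrite leq_mul2r small orbT.
  have [j i0E] : exists j, i0 = j + H + 1.
    by exists (i0 - (H + 1)); rewrite -addnA subnK // ltnW.
  have i0P : i0.-1 = j + H by rewrite i0E addn1.
  rewrite i0P in lo; have jq : j <= q by apply: leq_trans i0q;
    rewrite i0E -addnA leq_addr.
  have lo' : (o (j + H) - (j + H) * H) %/ H <= m.
    by move: lo; rewrite /f geq_min leqNgt mp.
  have lt : o (j + H) - (j + H) * H < m.+1 * H by rewrite -ltn_divLR.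
  have le := o_left (leq_addr H j); rewrite addKn in le.
  have ox : o j <= x.
    rewrite leqNgt; apply/negP => ox; have [Um Ud] := U_mono (ltnW ox).
    rewrite U_o // in Um Ud; have oj := o_ge j.
    have lt' := leq_ltn_trans le lt; rewrite mulSn addnC ltn_add2l in lt'.
    clear - lt' xE Um Ud ox oj; lia.
  have [Um _] := U_mono ox; rewrite U_o // in Um.
  by rewrite i0E -addnA mulnDl leq_add2r.
by rewrite [in leqRHS]yE [leqLHS in _ /\ leqLHS <= _]yE uE; move: dn;
  rewrite !mulnDl; lia.
Qed.

End Step.

Local Open Scope classical_set_scope.
Local Open Scope ring_scope.

(** * Odometers *)

Definition radix_prod (r : nat -> nat) (n : nat) : nat :=
  (\prod_(i < n) (r i).+2)%N.

(* The first n digits of x, as the number of a level of the n-th tower of the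
   odometer. *)
Definition index_of (r : nat -> nat) (n : nat) (x : odometer_space r) : nat :=
  (\sum_(i < n) x i * radix_prod r i)%N.

Definition tail_eq (r : nat -> nat) (n : nat) (x y : odometer_space r) : Prop :=
  forall i, (n <= i)%N -> x i = y i.

(** The point at level [k] of the n-th tower that shares the later digits of [x]: the witness
    whenever a neighbour is known only by its level. *)
Definition splice (r : nat -> nat) (n k : nat) (x : odometer_space r) :
    odometer_space r :=
  fun i => if (i < n)%N then inord ((k %/ radix_prod r i) %% (r i).+2)
           else x i.

Definition sub_with_borrow (r : nat -> nat) (x : odometer_space r) :
    odometer_space r :=
  fun n => if [forall i : 'I_n, x i == ord0] then ord_pred (x n) else x n.

Section Index.
Variable r : nat -> nat.
Local Notation X := (odometer_space r).
Local Notation H := (radix_prod r).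
Implicit Types (x y z : X) (n m k : nat).
Local Open Scope nat_scope.

Lemma radix_prodS n : H n.+1 = (r n).+2 * H n.
Proof. by rewrite /radix_prod big_ord_recr mulnC. Qed.

Lemma radix_prod0 : H 0 = 1. Proof. by rewrite /radix_prod big_ord0. Qed.

Lemma radix_prod_gt0 n : 0 < H n.
Proof. by rewrite prodn_gt0. Qed.
Hint Resolve radix_prod_gt0 : core.

Lemma radix_prod_gt n : n < H n.
Proof.
elim: n => [|n IH]; first by rewrite radix_prod0.
by rewrite radix_prodS; lia.
Qed.

Lemma index_ofS n x : index_of n.+1 x = x n * H n + index_of n x.
Proof. by rewrite /index_of big_ord_recr addnC. Qed.

Lemma index_of0 x : index_of 0 x = 0.
Proof. by rewrite /index_of big_ord0. Qed.

Lemma index_of_lt n x : index_of n x < H n.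
Proof.
elim: n => [|n IH]; first by rewrite index_of0.
rewrite index_ofS radix_prodS; have := ltn_ord (x n).
by rewrite -(leq_pmul2r (radix_prod_gt0 n)) mulSn; lia.
Qed.

Lemma index_of_mod n x : index_of n.+1 x %% H n = index_of n x.
Proof. by rewrite index_ofS modnMDl modn_small ?index_of_lt. Qed.

Lemma index_of_div n x : index_of n.+1 x %/ H n = x n.
Proof. by rewrite index_ofS divnMDl // divn_small ?index_of_lt ?addn0. Qed.

Lemma index_of_dec n m x : n <= m -> index_of m x %% H n = index_of n x.
Proof.
move=> /subnKC <-; elim: (m - n) => [|d IH].
  by rewrite addn0 modn_small ?index_of_lt.
rewrite addnS index_ofS -modnDm IH.
suff /dvdnP[u ->] : H n %| H (n + d) by rewrite mulnA modnMl add0n modn_small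
  ?index_of_lt.
elim: d {IH} => [|d IH]; first by rewrite addn0.
by rewrite addnS radix_prodS dvdn_mull.
Qed.

Lemma index_of_digits n x y :
  (forall i, i < n -> x i = y i) -> index_of n x = index_of n y.
Proof. by move=> xy; apply: eq_bigr => i _; rewrite xy. Qed.

Lemma digits_of_index n x y :
  index_of n x = index_of n y -> forall i, i < n -> x i = y i.
Proof.
move=> E i ni; apply: val_inj => /=.
by rewrite -!index_of_div -(index_of_dec _ ni) E index_of_dec.
Qed.

Lemma index_of_inj x y : (forall n, index_of n x = index_of n y) -> x = y.
Proof.
move=> E; apply: functional_extensionality_dep => i.
exact: (digits_of_index (E i.+1)).
Qed.

Lemma index_tail_inj n x y : tail_eq n x y -> index_of n x = index_of n y -> x = y.
Proof.
move=> t E; apply: functional_extensionality_dep => i.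
have [ni|ni] := leqP n i; first exact: t.
exact: (digits_of_index E).
Qed.

Lemma tail_eqW n m x y : n <= m -> tail_eq n x y -> tail_eq m x y.
Proof. by move=> nm t i mi; apply: t; apply: leq_trans mi. Qed.

Lemma tail_eq_sym n x y : tail_eq n x y -> tail_eq n y x.
Proof. by move=> t i /t. Qed.

Lemma tail_eq_trans n x y z : tail_eq n x y -> tail_eq n y z -> tail_eq n x z.
Proof. by move=> t t' i ni; rewrite t // t'. Qed.

Lemma tail_eq_splice n k x : tail_eq n x (splice n k x).
Proof. by move=> i ni; rewrite /splice ltnNge ni. Qed.

Lemma index_of_splice n k x : k < H n -> index_of n (splice n k x) = k.
Proof.
move=> kn; rewrite -[RHS](modn_small kn) /index_of.
have -> : \sum_(i < n) splice n k x i * H i =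
    \sum_(i < n) ((k %/ H i) %% (r i).+2) * H i.
  by apply: eq_bigr => i _; rewrite /splice ltn_ord inordK // ltn_mod.
elim: n {kn} => [|n IH]; first by rewrite big_ord0 radix_prod0 modn1.
rewrite big_ord_recr IH /= radix_prodS [in RHS](divn_eq k (H n)).
set u := k %/ H n; set b := k %% H n; set p := (r n).+2.
rewrite [in RHS](divn_eq u p) mulnDl -mulnA -addnA modnMDl addnC.
rewrite [in RHS]modn_small //.
have bH : b < H n by rewrite ltn_mod.
have : u %% p < p by rewrite ltn_mod.
by rewrite -(leq_pmul2r (radix_prod_gt0 n)) mulSn; lia.
Qed.

Lemma carry_index n x :
  [forall i : 'I_n, x i == ord_max] = ((index_of n x).+1 == H n).
Proof.
elim: n => [|n IH].
  by rewrite index_of0 radix_prod0; apply/forallP => -[].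
rewrite index_ofS radix_prodS.
have -> : [forall i : 'I_n.+1, x i == ord_max] =
    [forall i : 'I_n, x i == ord_max] && (x n == ord_max).
  apply/forallP/andP => [a|[/forallP a an] i].
    split; last exact: (a ord_max).
    by apply/forallP => i; apply: (a (widen_ord (leqnSn n) i)).
  have [ni|ni] := ltnP i n; first exact: (a (Ordinal ni)).
  by have -> : nat_of_ord i = n by have := ltn_ord i; lia.
rewrite IH -val_eqE /=; have := index_of_lt n x; have := ltn_ord (x n).
move: (nat_of_ord (x n)) (index_of n x) => a b ap bH.
by apply/andP/eqP => [[/eqP <- /eqP ->]|]; nia.
Qed.

Lemma borrow_index n x :
  [forall i : 'I_n, x i == ord0] = (index_of n x == 0).
Proof.
rewrite sum_nat_eq0; apply/eq_forallb => i.
by rewrite muln_eq0 orbC eqn0Ngt radix_prod_gt0.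
Qed.

(** The space is treated as the inverse limit of the cyclic groups of order [H n]: a point is
    determined by its indices, and the odometer adds 1 to each of them. *)
Lemma index_of_add n x :
  index_of n (add_with_carry x) = (index_of n x).+1 %% H n.
Proof.
elim: n => [|n IH]; first by rewrite index_of0 radix_prod0 modn1.
rewrite !index_ofS IH /add_with_carry carry_index radix_prodS.
have := index_of_lt n x; have := ltn_ord (x n).
case: eqP => [E _ _|ne]; last first.
  move: (nat_of_ord _) (index_of n x) ne => a b ne ap bH.
  by rewrite !modn_small //; nia.
rewrite E modnn addn0 /= -addnS E -[X in _ = (_ + X) %% _]mul1n -mulnDl addn1.
by rewrite muln_modl.
Qed.

Lemma index_of_sub n x :
  index_of n (sub_with_borrow x) = (index_of n x + (H n).-1) %% H n.
Proof.
elim: n => [|n IH]; first by rewrite index_of0 radix_prod0 modn1.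
rewrite !index_ofS IH /sub_with_borrow borrow_index radix_prodS.
have := index_of_lt n x; have := ltn_ord (x n).
have := radix_prod_gt0 n.
case: eqP => [-> H0 _ _|ne H0].
  rewrite add0n modn_small ?prednK // addn0 /ord_pred /=.
  rewrite (_ : x n * H n + _ = (x n + (r n).+1) * H n + (H n).-1); last first.
    by case: (H n) H0 => // h _ /=; nia.
  rewrite (_ : (x n + (r n).+2).-1 = x n + (r n).+1); last by rewrite addnS.
  set u := (x n + _)%N; have := divn_eq u (r n).+2.
  set v := u %/ _; set w := u %% _ => ->.
  rewrite mulnDl -mulnA -addnA modnMDl modn_small //.
  have : w < (r n).+2 by rewrite ltn_mod.
  by case: (H n) H0 => // h _ /=; nia.
move: (nat_of_ord _) (index_of n x) ne (H n) H0 => a b ne h h0 ap bh.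
rewrite (_ : b + h.-1 = b.-1 + h); last by lia.
rewrite modnDr [b.-1 %% _]modn_small; last by lia.
rewrite (_ : a * h + b + _ = a * h + b.-1 + (r n).+2 * h); last by lia.
by rewrite modnDr modn_small //; nia.
Qed.

Lemma add_with_carryK : cancel (@add_with_carry r) (@sub_with_borrow r).
Proof.
move=> x; apply: index_of_inj => n.
rewrite index_of_sub index_of_add modnDml addSnnS prednK //.
by rewrite modnDr modn_small ?index_of_lt.
Qed.

Lemma sub_with_borrowK : cancel (@sub_with_borrow r) (@add_with_carry r).
Proof.
move=> x; apply: index_of_inj => n.
rewrite index_of_add index_of_sub -addn1 modnDml -addnA addn1 prednK //.
by rewrite modnDr modn_small ?index_of_lt.
Qed.

Lemma index_of_addn n k x :
  index_of n (iter k (@add_with_carry r) x) = (index_of n x + k) %% H n.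
Proof.
elim: k => [|k IH]; first by rewrite addn0 modn_small ?index_of_lt.
by rewrite iterS index_of_add IH -addn1 modnDml -addnA addn1.
Qed.

Lemma iter_add_with_carry_neq k x :
  0 < k -> iter k (@add_with_carry r) x <> x.
Proof.
(* The quotient of order [H k] already separates the two points, because [0 < k < H k]. *)
move=> k0 E; have /eqP := index_of_addn k k x; rewrite E.
rewrite -{1}[index_of k x](modn_small (index_of_lt k x)).
rewrite -[X in X == _ %[mod _]]addn0 eqn_modDl mod0n modn_small ?radix_prod_gt //.
by move/eqP; lia.
Qed.

Lemma measurable_index n (Q : set nat) :
  measurable [set x : X | Q (index_of n x)].
Proof.
have single k : measurable [set x : X | index_of n x = k].
  elim: n k => [|n IH] k.
    rewrite (_ : [set _ | _] = [set x | 0 = k]).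
      by have [->|k0] := eqVneq k 0; [rewrite (_ : [set _ | _] = setT)|
        rewrite (_ : [set _ | _] = set0)]; rewrite // predeqE => x;
          split => //= /esym/eqP; rewrite (negbTE k0).
    by apply/seteqP; split=> x /=; rewrite index_of0.
  pose a : 'I_(r n).+2 := inord (k %/ H n).
  have mD : measurable [set x : X | x n = a].
    by apply: sub_sigma_algebra; exists n, a.
  have [kH|kH] := ltnP k (H n.+1); last first.
    rewrite (_ : [set _ | _] = set0) // predeqE => x; split=> //= E.
    by have := index_of_lt n.+1 x; rewrite E ltnNge kH.
  have aE : a = k %/ H n :> nat by rewrite inordK // ltn_divLR // -radix_prodS.
  rewrite (_ : [set _ | _] = [set x : X | x n = a] `&`
                             [set x | index_of n x = k %% H n]).
    exact: measurableI.
  apply/seteqP; split=> x /=.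
    move=> xk; rewrite -{1}xk index_of_mod; split=> //; apply: val_inj.
    by rewrite /= aE -xk index_of_div.
  by case=> xn xm; rewrite index_ofS xn xm aE -divn_eq.
rewrite (_ : [set _ | _] = \bigcup_(k in Q) [set x : X | index_of n x = k]).
  by apply: bigcup_measurable => k _; apply: single.
by apply/seteqP; split=> [x /= Qx|x [k /= Qk ->]//]; exists (index_of n x).
Qed.

Lemma measurable_of_index (f : X -> X) (g : nat -> nat -> nat) :
  (forall n x, index_of n (f x) = g n (index_of n x)) ->
  measurable_fun setT f.
Proof.
move=> fg; apply: (@measurability _ _ X X setT f (@digit_sets r)) => // _ [_ [n
  [a ->]] <-].
rewrite setTI (_ : _ @^-1` _ =
  [set x : X | [set k | g n.+1 k %/ H n = a] (index_of n.+1 x)]).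
  exact: measurable_index.
apply/seteqP; split=> x /=; rewrite -fg index_of_div; first by move=> ->.
exact: val_inj.
Qed.

End Index.

#[global] Hint Resolve radix_prod_gt0 : core.

(** * The uniform measure on the odometer space and its invariance *)

Section Uniform.
Variables (R : realType) (r : nat -> nat).
Local Notation X := (odometer_space r).
Local Notation H := (radix_prod r).
Implicit Types (P Q : probability X R).

Lemma uniform_index P n k : product_of_uniforms P -> (k < H n)%N ->
  P [set x | index_of n x = k] = ((H n)%:R^-1)%:E.
Proof.
move=> unif kn; pose a := splice n k (point : X).
have <- : (\prod_(i < n) ((r i).+2%:R)^-1)%:E = ((H n)%:R^-1 : R)%:E.
  by rewrite prodfV natr_prod.
rewrite -(unif n a); congr (P _); apply/seteqP; split=> x /= E.
  by move=> i ni; apply: (digits_of_index _ ni); rewrite E index_of_splice.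
by rewrite (index_of_digits E) index_of_splice.
Qed.

Lemma uniform_index_le P n k : product_of_uniforms P ->
  (P [set x | index_of n x = k] <= ((H n)%:R^-1)%:E)%E.
Proof.
move=> unif; have [kn|kn] := ltnP k (H n); first by rewrite uniform_index.
rewrite (_ : [set _ | _] = set0) ?measure0 ?lee_fin ?invr_ge0//.
by rewrite predeqE => x; split=> //= E; have := index_of_lt n x;
  rewrite E ltnNge kn.
Qed.

(** Cylinders form a pi-system: two of them are nested or disjoint, according to the residue of the
    deeper index. *)
Lemma measure_index_unique (m1 m2 : {measure set X -> \bar R}) :
  (m1 setT < +oo)%E ->
  (forall n k, (k < H n)%N ->
    m1 [set x | index_of n x = k] = m2 [set x | index_of n x = k]) ->
  forall A, measurable A -> m1 A = m2 A.
Proof.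
move=> m1T m12; pose G := [set A : set X | exists n k, A = [set x | index_of n
  x = k]].
apply: (@measure_unique _ _ _ G (fun=> setT)) => //.
- apply/seteqP; split; apply: smallest_sub; try exact: sigma_algebra_measurable.
  + exact: smallest_sigma_algebra.
  + move=> _ [n [a ->]].
    rewrite (_ : [set _ | _] = \bigcup_(k in [set k | (k %/ H n)%N = a])
      [set x : X | index_of n.+1 x = k]).
      have sG : sigma_algebra setT <<s G >> := smallest_sigma_algebra _ _.
      apply: (@bigcup_measurable _ (g_sigma_algebraType G)) => k _.
      by apply: sub_sigma_algebra; exists n.+1, k.
    apply/seteqP; split=> x /=.
      by move=> xa; exists (index_of n.+1 x) => //=; rewrite index_of_div xa.
    by case=> k /= ka xk; apply: val_inj; rewrite /= -ka -xk index_of_div.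
  + by move=> _ [n [k ->]]; apply: (@measurable_index r n [set k]).
- move=> _ _ [n [k ->]] [m [l ->]].
  wlog nm : n m k l / (n <= m)%N.
    by move=> W; have [/W//|/ltnW/W] := leqP n m; rewrite setIC.
  have [E|ne] := eqVneq (l %% H n)%N k.
    exists m, l; apply/seteqP; split=> x /=; first by case.
    by move=> xl; split=> //; rewrite -E -xl index_of_dec.
  (* The empty intersection is itself of the required form, [index_of 0] being constantly 0. *)
  exists 0%N, 1%N; apply/seteqP; split=> x /=; last by rewrite index_of0.
  by case=> xk xl; move: ne; rewrite -xk -xl index_of_dec ?eqxx.
- by move=> _; exists 0%N, 0%N; apply/seteqP; split=> x //=; rewrite index_of0.
- by rewrite bigcup_const.
- move=> _ [n [k ->]]; have [kn|kn] := ltnP k (H n); first exact: m12.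
  rewrite (_ : [set _ | _] = set0) ?measure0 // predeqE => x; split=> //= E.
  by have := index_of_lt n x; rewrite E ltnNge kn.
Qed.

Lemma add_measurable : measurable_fun setT (@add_with_carry r).
Proof.
by apply: (@measurable_of_index _ _ (fun n k => (k.+1 %% H n)%N)) => n x;
  exact: index_of_add.
Qed.

Lemma sub_measurable : measurable_fun setT (@sub_with_borrow r).
Proof.
by apply: (@measurable_of_index _ _ (fun n k => ((k + (H n).-1) %% H n)%N)) =>
  n x; exact: index_of_sub.
Qed.

Lemma add_preserves P : product_of_uniforms P ->
  forall B, measurable B -> P (@add_with_carry r @^-1` B) = P B.
Proof.
move=> unif B mB.
pose f : {mfun X >-> X} := mfun_Sub (mem_set add_measurable : _ \in mfun).
have [m mE] : exists m : {measure set X -> \bar R}, forall A, m A = P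
  (@add_with_carry r @^-1` A).
  by exists (distribution P f).
rewrite -mE; apply: measure_index_unique mB => [|n k kn].
  by rewrite mE preimage_setT probability_setT ltry.
have k'n : ((k + (H n).-1) %% H n < H n)%N by rewrite ltn_mod.
rewrite mE; apply: etrans (esym (uniform_index unif kn)).
apply: etrans (uniform_index unif k'n).
congr (P _); apply/seteqP; split=> x /=; rewrite index_of_add.
  move=> <-; rewrite modnDml addSnnS prednK // modnDr modn_small //.
  exact: index_of_lt.
by move=> ->; rewrite -addn1 modnDml -addnA addn1 prednK // modnDr modn_small.
Qed.

Definition odometer P (unif : product_of_uniforms P) : aut P :=
  MpIso (@add_with_carryK r) (@sub_with_borrowK r) add_measurable
    sub_measurable (add_preserves unif).

End Uniform.

(** * Existence of the uniform measure and absence of atoms *)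

Section UniformExists.
Variables (R : realType) (r : nat -> nat).
Local Notation X := (odometer_space r).
Local Notation H := (radix_prod r).

(** The mixed-radix expansion of a real in [0, 1); the absolute value extends the truncation to the
    whole line. *)
Definition expansion (t : R) : X :=
  fun n => inord (Num.truncn (`|t| * (H n.+1)%:R) %% (r n).+2).

Let truncE (t : R) n k : Num.truncn (`|t| * (H n)%:R) = k <->
  k%:R <= `|t| * (H n)%:R < k.+1%:R.
Proof.
have t0 : 0 <= `|t| * (H n)%:R by rewrite mulr_ge0.
by split=> [<-|]; [exact: truncn_itv | move=> h; apply/eqP; rewrite truncn_eq].
Qed.

Lemma measurable_expansion : measurable_fun setT expansion.
Proof.
apply: (@measurability _ _ _ X setT _ (@digit_sets r)) => // _ [_ [n [a ->]] <-].
rewrite setTI (_ : _ @^-1` _ = \bigcup_(k in [set k | (k %% (r n).+2)%N = a])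
   ((fun t : R => `|t| * (H n.+1)%:R) @^-1` `[k%:R, k.+1%:R[)).
  apply: bigcup_measurable => k _; rewrite -[X in measurable X]setTI.
  have mf : measurable_fun setT (fun t : R => `|t| * (H n.+1)%:R).
    by apply: measurable_funM => //; exact: measurableT_comp.
  exact: mf.
apply/seteqP; split=> t /=.
  move=> <-; exists (Num.truncn (`|t| * (H n.+1)%:R)) => /=.
    by rewrite inordK ?ltn_mod.
  by rewrite in_itv /=; apply/truncE.
case=> k /= ka; rewrite in_itv /= => /truncE E.
by apply: val_inj; rewrite /= inordK ?ltn_mod // E.
Qed.

(* The first n digits with the most significant one first: unlike index_of,
   this is the integer part of t * H n. *)
Let prefix (n : nat) (x : X) : nat :=
  nat_rect (fun=> nat) 0%N (fun i k => (k * (r i).+2 + x i)%N) n.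

Let prefixS n x : prefix n.+1 x = (prefix n x * (r n).+2 + x n)%N.
Proof. by []. Qed.

Let prefix_lt n x : (prefix n x < H n)%N.
Proof.
elim: n => [|n IH]; first by rewrite radix_prod0.
rewrite prefixS radix_prodS mulnC; have := ltn_ord (x n).
by move: (nat_of_ord (x n)) => u; nia.
Qed.

Let prefix_inj n x y : prefix n x = prefix n y ->
  forall i, (i < n)%N -> x i = y i.
Proof.
elim: n => // n IH; rewrite !prefixS => E i; rewrite ltnS leq_eqVlt.
have xy : x n = y n.
  apply: val_inj => /=; have := congr1 (modn^~ (r n).+2) E.
  by rewrite /= !modnMDl !modn_small.
by move=> /predU1P[->//|]; apply: IH; move: E; rewrite xy => /addIn/eqP;
  rewrite eqn_pmul2r // => /eqP.
Qed.

Let prefix_expansion n (t : R) : 0 <= t < 1 ->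
  prefix n (expansion t) = Num.truncn (`|t| * (H n)%:R).
Proof.
move=> /andP[t0 t1]; elim: n => [|n IH].
  apply/esym/truncE; rewrite radix_prod0 mulr1 ger0_norm // t0 /=; lra.
rewrite prefixS IH /expansion inordK ?ltn_mod //.
rewrite [RHS](divn_eq _ (r n).+2); congr (_ * _ + _)%N.
apply/truncE; have /truncE/andP[] := erefl (Num.truncn (`|t| * (H n.+1)%:R)).
set u := Num.truncn _; have p0 : 0 < (r n).+2%:R :> R by [].
rewrite radix_prodS natrM mulrCA => u1 u2; apply/andP; split.
  rewrite -(ler_pM2l p0); apply: le_trans u1.
  by rewrite -natrM ler_nat mulnC leq_trunc_div.
rewrite -(ltr_pM2l p0); apply: lt_le_trans u2 _.
by rewrite -natrM ler_nat mulnC ltn_ceil.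
Qed.

Let U := uniform_prob (@ltr01 R).

(** The uniform law is given on the closed interval, whereas [prefix_expansion] fails at the
    endpoint 1; this endpoint is discarded as a null set. *)
Let uniform_restr (A : set R) : measurable A -> U A = U (A `&` `[0, 1[).
Proof.
move=> mA; have mI : measurable (`[0, 1[ : set R) by [].
have UI : U `[0, 1[ = 1%E.
  rewrite /U /uniform_prob;
    have -> : 1%E = (\int[lebesgue_measure]_(x in `[0%R, 1%R]) (uniform_pdf 0 1
      x)%:E)%E :> \bar R.
    by rewrite integral_uniform_pdf1.
  apply: integral_itv_bndo_bndc; apply/measurable_EFinP/measurable_funTS.
  exact: measurable_uniform_pdf.
have UC : U (~` `[0, 1[) = 0%E.
  by apply: etrans (probability_setC (uniform_prob (@ltr01 R)) mI) _;
    rewrite -[RHS](@subee R 1%E) //; congr (_ - _)%E; exact: UI.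
have U0 : U (A `\` `[0, 1[) = 0%E.
  apply/eqP; rewrite eq_le measure_ge0 andbT -UC; apply: le_measure;
    rewrite ?inE //.
  - exact: measurableD.
  - exact: measurableC.
rewrite -{1}(setUIDK A `[0, 1[).
by apply: measureU0 => //; [exact: measurableI | exact: measurableD].
Qed.

Let uniform_itv (c d : R) : 0 <= c -> c <= d -> d <= 1 ->
  U `[c, d[ = (d - c)%:E.
Proof.
move=> c0 cd d1; rewrite /U /uniform_prob.
rewrite (eq_integral (fun=> 1%E)); last first.
  move=> x; rewrite inE /= in_itv /= => /andP[cx xd]; rewrite /uniform_pdf.
  by rewrite (le_trans c0 cx) (le_trans (ltW xd) d1) /= subr0 invr1.
rewrite integral_cst // mul1e; apply: etrans (lebesgue_measure_itv `[c, d[) _.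
rewrite /= lte_fin.
have [->|] := eqVneq c d; first by rewrite ltxx subrr.
by rewrite lt_def eq_sym cd andbT => ->.
Qed.

(** The measure is the law of [expansion]: within [0, 1), a cylinder of depth [n] becomes an
    interval of length [1 / H n]. *)
Lemma uniform_exists : exists P : probability X R, product_of_uniforms P.
Proof.
have mf : @measurable_fun _ _ (measurableTypeR R) X setT expansion.
  exact: measurable_expansion.
pose f : {mfun measurableTypeR R >-> X} := HB.pack expansion
  (isMeasurableFun.Build _ _ (measurableTypeR R) X expansion mf).
exists (distribution (uniform_prob (@ltr01 R)) f) => n a.
have n0 : (0 : R) < (H n)%:R by rewrite ltr0n.
have -> : \prod_(i < n) ((r i).+2%:R)^-1 = (H n)%:R^-1 :> R.
  by rewrite prodfV natr_prod.
apply: etrans (uniform_restr _) _.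
  rewrite -[X in measurable X]setTI; apply: measurable_expansion => //.
  rewrite (_ : [set _ | _] = [set x : X | [set index_of n a] (index_of n x)]).
    exact: measurable_index.
  by apply/seteqP; split=> x /=; [exact: index_of_digits | exact: digits_of_index].
rewrite [X in U X](_ : _ `&` _ = `[(prefix n a)%:R / (H n)%:R, (prefix n
  a).+1%:R / (H n)%:R[%classic).
  have a1 := prefix_lt n a.
  rewrite uniform_itv.
  - by rewrite -mulrBl -natrB // subSnn mul1r.
  - by rewrite divr_ge0.
  - by rewrite ler_pM2r ?invr_gt0 // ler_nat.
  - by rewrite ler_pdivrMr // mul1r ler_nat.
apply/seteqP; split=> t /=; rewrite !in_itv /=.
  case=> ta t01; have := prefix_expansion n t01.
  have -> : prefix n (f t) = prefix n a.
    elim: n {n0} ta => // n IH ta; rewrite !prefixS; congr (_ * _ + _)%N.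
      by apply: IH => i ni; apply: ta; apply: leqW.
    by congr nat_of_ord; apply: ta.
  move=> /esym/truncE; rewrite ger0_norm; last by case/andP: t01.
  by rewrite ler_pdivrMr // ltr_pdivlMr.
rewrite ler_pdivrMr // ltr_pdivlMr // => ta.
have t01 : 0 <= t < 1.
  case/andP: ta => h1 h2; apply/andP; split.
    by rewrite -(pmulr_lge0 _ n0) (le_trans _ h1).
  by rewrite -(ltr_pM2r n0) mul1r (lt_le_trans h2) // ler_nat prefix_lt.
split=> //; apply: prefix_inj; rewrite prefix_expansion //; apply/truncE.
by rewrite ger0_norm //; case/andP: t01.
Qed.

(** Once [1 / H n] is below [P A], some cylinder of depth [n] cuts out of [A] a part of positive but
    smaller measure. *)
Lemma uniform_atomless (P : probability X R) : product_of_uniforms P -> atomless P.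
Proof.
move=> unif A mA A0; have [n nA] : exists n, (((H n)%:R^-1 : R)%:E < P A)%E.
  have PA : P A \is a fin_num := fin_num_measure P A mA.
  have a0 : 0 < fine (P A) by rewrite fine_gt0 // A0 ltey_eq PA.
  exists (Num.truncn (fine (P A))^-1).+1; rewrite -(fineK PA) lte_fin.
  rewrite invf_plt ?posrE ?ltr0n //; apply: lt_trans (truncnS_gt _) _.
  by rewrite ltr_nat radix_prod_gt.
pose F k := A `&` [set x | index_of n x = k].
have mF k : measurable (F k).
  by apply: measurableI => //; apply: (@measurable_index r n [set k]).
have [k Fk] : exists k, (0 < P (F k))%E.
  apply: contrapT => /forallNP no.
  have : P.-negligible A.
    apply: (@negligibleS _ _ _ _ (\bigcup_k F k)).
      by move=> x Ax; exists (index_of n x).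
    apply: negligible_bigcup => k; exists (F k); split=> //.
    by apply/eqP; rewrite -measure_le0 leNgt; apply/negP; exact: no.
  by move/(negligibleP P mA) => P0; rewrite P0 ltxx in A0.
exists (F k); split=> //; first by move=> x [].
apply: le_lt_trans nA; apply: le_trans (uniform_index_le n k unif).
by apply: le_measure; rewrite ?inE //;
  [exact: (@measurable_index r n [set k])|move=> x []].
Qed.

End UniformExists.

(** * The odometer space as a Borel subset of the line *)

Section StandardBorel.
Variables (R : realType) (r : nat -> nat).
Local Notation X := (odometer_space r).
Local Notation H := (radix_prod r).

(* The factor 2 separates the cells of distinct prefixes, as in the Cantor
   set, so that a point of the image determines the digits. *)
Let G (n : nat) : R := \prod_(i < n) (2 * (r i).+2%:R).

Let GS n : G n.+1 = G n * (2 * (r n).+2%:R).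
Proof. by rewrite /G big_ord_recr. Qed.

Let G_gt0 n : 0 < G n.
Proof. by apply: prodr_gt0 => i _; rewrite mulr_gt0. Qed.

Let G_ge1 n : 1 <= G n.
Proof.
elim: n => [|n IH]; first by rewrite /G big_ord0.
rewrite GS; have : 2 <= (r n).+2%:R :> R by rewrite ler_nat.
by nra.
Qed.

Let G_gt n : n%:R < G n.
Proof.
elim: n => [|n IH]; first by rewrite /G big_ord0.
rewrite GS -natr1; have : 2 <= (r n).+2%:R :> R by rewrite ler_nat.
by have := G_ge1 n; nra.
Qed.

Let partial (n : nat) (x : X) : R := \sum_(i < n) (x i)%:R / G i.+1.

Let partialS n x : partial n.+1 x = partial n x + (x n)%:R / G n.+1.
Proof. by rewrite /partial big_ord_recr. Qed.

(** Half the step [1 / G n] between neighbouring cells of depth [n], so that they stay apart. *)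
Let width (n : nat) : R := (2 * G n)^-1.

Let widthE n : width n = (r n).+2%:R / G n.+1.
Proof.
have p0 : (r n).+2%:R != 0 :> R by rewrite pnatr_eq0.
have g0 : G n != 0 by rewrite gt_eqF.
rewrite /width GS; move: p0 g0; move: (_.+2%:R) (G n) => a b a0 b0.
by field; apply/andP.
Qed.

Let widthS n : width n.+1 = 2^-1 / G n.+1.
Proof. by rewrite /width invfM. Qed.

Let cell (n : nat) (x : X) : set R := `[partial n x, partial n x + width n]%classic.

Let cell_sub n x : cell n.+1 x `<=` cell n x.
Proof.
move=> y; rewrite /cell /= !in_itv /= partialS widthS widthE => /andP[y1 y2].
have g : 0 < (G n.+1)^-1 by rewrite invr_gt0.
have xl : (x n)%:R + 1 <= (r n).+2%:R :> R by rewrite natr1 ler_nat.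
apply/andP; split.
  by apply: le_trans y1; rewrite lerDl divr_ge0 // ltW.
by apply: le_trans y2 _; rewrite -addrA lerD2l -mulrDl ler_pM2r //; lra.
Qed.

Let cell_sub_le n m x : (n <= m)%N -> cell m x `<=` cell n x.
Proof.
move=> /subnKC <-; elim: (m - n)%N => [|d IH]; first by rewrite addn0.
by rewrite addnS; apply: subset_trans IH; apply: cell_sub.
Qed.

Let partial_eq n x y : (forall i, (i < n)%N -> x i = y i) -> partial n x =
  partial n y.
Proof. by move=> xy; apply: eq_bigr => i _; rewrite xy. Qed.

Let cell_inj n x x' y : cell n x y -> cell n x' y ->
  forall i, (i < n)%N -> x i = x' i.
Proof.
elim: n => // n IH c c' i.
have {}IH : forall i, (i < n)%N -> x i = x' i.
  by apply: IH; apply: cell_sub.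
rewrite ltnS leq_eqVlt => /predU1P[->|]; last exact: IH.
move: c c'; rewrite /cell /= !in_itv /= !partialS widthS (partial_eq IH).
have g := G_gt0 n.+1.
set a := partial n x'; set z := (y - a) * G n.+1.
have yE : y = a + z / G n.+1 by rewrite /z mulfK ?gt_eqF // addrC subrK.
rewrite yE -!addrA -!mulrDl !lerD2l !ler_pM2r ?invr_gt0 // => /andP[h1 h2]
  /andP[h3 h4].
apply: val_inj => /=; have [lt|lt|//] := ltngtP (x n) (x' n); exfalso.
  have : (x n)%:R + 1 <= (x' n)%:R :> R by rewrite natr1 ler_nat.
  by lra.
have : (x' n)%:R + 1 <= (x n)%:R :> R by rewrite natr1 ler_nat.
by lra.
Qed.

Let embed (x : X) : R := sup (range (partial^~ x)).

Let partial_cell n x : cell n x (partial n x).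
Proof. by rewrite /cell /= in_itv /= lexx lerDl /width invr_ge0 mulr_ge0 //
  ltW. Qed.

Let partial_mono n m x : (n <= m)%N -> partial n x <= partial m x.
Proof. by move=> nm; have := cell_sub_le nm (partial_cell m x);
  rewrite /cell /= in_itv /= => /andP[]. Qed.

Let embed_cell n x : cell n x (embed x).
Proof.
have ub m : ubound (range (partial^~ x)) (partial m x + width m).
  move=> _ [k _ <-]; have [km|/ltnW mk] := leqP k m.
    apply: le_trans (partial_mono x km) _.
    by have := partial_cell m x; rewrite /cell /= in_itv /= => /andP[].
  by have := cell_sub_le mk (partial_cell k x);
    rewrite /cell /= in_itv /= => /andP[].
rewrite /cell /= in_itv /=; apply/andP; split.
  by apply: ub_le_sup; [exists (partial n x + width n); exact: ub | exists n].
by apply: ge_sup; [exists (partial n x), n | exact: ub].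
Qed.

Let embed_inj : injective embed.
Proof.
move=> x y xy; apply: index_of_inj => n; apply: index_of_digits.
by apply: cell_inj (embed_cell n x) _; rewrite xy.
Qed.

Let cell_close n x y z : cell n x y -> cell n x z -> `|y - z| < n.+1%:R^-1.
Proof.
rewrite /cell /= !in_itv /= => /andP[y1 y2] /andP[z1 z2].
apply: (@le_lt_trans _ _ (width n)); first by rewrite ler_norml; lra.
rewrite /width ltf_pV2 ?posrE ?mulr_gt0 //; have := G_gt n.
by have := G_ge1 n; rewrite -natr1; lra.
Qed.

Let center n k : X := splice n k point.

Let center_index n x i : (i < n)%N -> center n (index_of n x) i = x i.
Proof. by apply: digits_of_index; rewrite index_of_splice ?index_of_lt. Qed.

Let cell_center n x : cell n (center n (index_of n x)) = cell n x.
Proof.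
by rewrite /cell (@partial_eq n _ x) // => i; exact: center_index.
Qed.

(** The range is a Cantor set: a real lying in some cell of every depth comes from a point, because
    [cell_inj] makes the prefixes chosen at the various depths compatible. *)
Let image_embed : range embed =
  \bigcap_n \bigcup_(k in [set k | (k < H n)%N]) cell n (center n k).
Proof.
apply/seteqP; split=> [_ [x _ <-] n _|y yc].
  by exists (index_of n x); rewrite /= ?index_of_lt // cell_center.
have {}yc n : exists k, (k < H n)%N /\ cell n (center n k) y.
  by have [k ? ?] := yc n I; exists k.
have [k ky] := choice yc.
pose x : X := fun i => center i.+1 (k i.+1) i.
have xc n i : (i < n)%N -> x i = center n (k n) i.
  move=> ni; apply: (@cell_inj i.+1 (center _ _) _ y) => //;
    first by have [] := ky i.+1.
  by apply: (cell_sub_le ni); have [] := ky n.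
have yx n : cell n x y.
  by have [_] := ky n; rewrite /cell -(@partial_eq n x) // => i; exact: xc.
exists x => //; apply/eqP; rewrite -subr_eq0 -normr_le0.
apply/ler_addgt0Pl => e e0; rewrite addr0.
have := ltW (cell_close (embed_cell (Num.truncn e^-1) x) (yx _)).
move=> /le_trans; apply; rewrite invf_ple ?posrE ?ltr0n //.
exact: ltW (truncnS_gt _).
Qed.

Let image_cylinder n x : embed @` [set z | index_of n z = index_of n x] =
  range embed `&` cell n x.
Proof.
apply/seteqP; split=> [_ [z /= zx <-]|_ [[z _ <-] zc]].
  by split; [exists z | rewrite -cell_center -zx cell_center].
exists z => //=; apply: index_of_digits => i.
exact: (@cell_inj n z x (embed z) (embed_cell n z) zc).
Qed.

(** Cylinders are sent to traces of closed cells on the range. Conversely, the preimage of an open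
    set is the union of the cylinders whose cells it contains, since cells shrink to points. *)
Lemma odometer_standard : standard_borel R X.
Proof.
pose B := g_sigma_algebraType (@open R).
have cellB n x : measurable (cell n x : set B).
  rewrite -[cell n x]setCK; apply: measurableC; apply: sub_sigma_algebra.
  by rewrite openC; exact: itv_closed.
have rangeB : measurable (range embed : set B).
  rewrite image_embed; apply: bigcapT_measurable => n.
  by apply: bigcup_measurable => k _; exact: cellB.
exists R, embed; split; first exact: Rhausdorff.
- exists (range ratr); split; last exact: dense_rat.
  by apply: (sub_countable (card_image_le _ _)); exact: countableP.
- exact: embed_inj.
- move=> A; split.
    move=> mA; suff: measurable (embed @` A : set B) by [].
    move: A mA; apply: smallest_sub.
      split=> [|A mA|F mF] /=.
      + by rewrite image_set0; exact: measurable0.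
      + rewrite (_ : _ @` _ = range embed `\` embed @` A).
          exact: measurableD.
        apply/seteqP; split=> [_ [x [_ nA] <-]|_ [[x _ <-] nA]].
          by split; [exists x | move=> [y Ay /embed_inj yx]; apply: nA;
            rewrite -yx].
        by exists x => //; split=> // Ax; apply: nA; exists x.
      + by rewrite image_bigcup; apply: bigcupT_measurable.
    move=> _ [n [a ->]].
    rewrite (_ : _ @` _ = \bigcup_(k in [set k | (k < H n.+1)%N /\ (k %/ H n)%N
      = a])
       (range embed `&` cell n.+1 (center n.+1 k))).
      by apply: bigcup_measurable => k _; apply: measurableI.
    apply/seteqP; split=> [_ [x /= xa <-]|y [k [kH ka]]].
      exists (index_of n.+1 x) => /=; first by rewrite index_of_lt index_of_div xa.
      by split; [exists x | rewrite cell_center].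
    rewrite -image_cylinder => -[z /= zk <-]; exists z => //=.
    by apply: val_inj; rewrite /= -ka -index_of_div zk index_of_splice.
  move=> mA.
  suff pre (D : set R) : <<s @open R >> D -> measurable (embed @^-1` D).
    rewrite (_ : A = embed @^-1` (embed @` A)); first exact: pre.
    by apply/seteqP; split=> [x Ax|x [y Ay /embed_inj <-]//]; exists x.
  move: D; apply: smallest_sub => [|D oD].
    split=> [|D mD|F mF] /=.
    + by rewrite preimage_set0; exact: measurable0.
    + by rewrite setTD preimage_setC; apply: measurableC.
    + by rewrite preimage_bigcup; apply: bigcupT_measurable.
  rewrite /= (_ : _ @^-1` _ = \bigcup_n
      [set x : X | [set k | cell n (center n k) `<=` D] (index_of n x)]).
    by apply: bigcupT_measurable => n; exact: measurable_index.
  apply/seteqP; split=> [x Dx|x [n _ /=]]; last first.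
    by rewrite cell_center; apply; exact: embed_cell.
  have /nbhs_ballP[e /= e0 eD] := open_nbhs_nbhs (conj oD Dx).
  exists (Num.truncn e^-1) => //=; rewrite cell_center => y yc; apply: eD.
  rewrite /ball /=; apply: lt_trans (cell_close (embed_cell _ x) yc) _.
  rewrite invf_plt ?posrE ?ltr0n //; exact: truncnS_gt.
Qed.

End StandardBorel.

(** * Automorphisms defined by cocycles *)

Section Automorphisms.
Variables (R : realType) (d : measure_display) (X : measurableType d).
Variable mu : probability X R.
Implicit Types (T V : aut mu) (A B : set X).

Lemma aut_inv_preserves T B : measurable B -> mu (mp_inv T @^-1` B) = mu B.
Proof.
move=> mB; rewrite -(@mp_fun_pushforward _ _ _ _ _ _ _ T); last first.
  by rewrite -[X in measurable X]setTI; apply: mp_inv_measurable.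
by congr (mu _); apply/seteqP; split=> x; rewrite /= mp_funK.
Qed.

Definition aut_inv T : aut mu :=
  MpIso (mp_invK T) (mp_funK T) (mp_inv_measurable T) (mp_fun_measurable T)
    (aut_inv_preserves T).

Lemma iter_measurable T n : measurable_fun setT (iter n T).
Proof.
elim: n => [|n IH]; first exact: measurable_id.
exact: measurableT_comp (mp_fun_measurable T) IH.
Qed.

Lemma iter_preserves T n B : measurable B -> mu (iter n T @^-1` B) = mu B.
Proof.
elim: n B => // n IH B mB; have mT : measurable (T @^-1` B).
  by rewrite -[X in measurable X]setTI; apply: mp_fun_measurable.
by rewrite -[RHS](mp_fun_pushforward T mB) -(IH _ mT).
Qed.

Lemma zpow_measurable T k : measurable_fun setT (zpow T k).
Proof. by case: k => n; [exact: iter_measurable|exact: (iter_measurable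
  (aut_inv T) n.+1)]. Qed.

Lemma zpow_preserves T k B : measurable B -> mu (zpow T k @^-1` B) = mu B.
Proof. by case: k => n; [exact: iter_preserves|exact: (@iter_preserves (aut_inv
  T) n.+1)]. Qed.

Lemma iter_cancel (f g : X -> X) n : cancel f g -> cancel (iter n f) (iter n g).
Proof. by move=> fK; elim: n => // n IH x; rewrite iterSr /= fK IH. Qed.

Lemma zpowK T k : cancel (zpow T k) (zpow T (- k)).
Proof.
case: k => [[|n]|n]; first by [].
- exact: (@iter_cancel _ _ n.+1 (mp_funK T)).
- exact: (@iter_cancel _ _ n.+1 (mp_invK T)).
Qed.

(** Identifies the powers of [T] through a relation graded by integers; additivity reduces all
    grades to 1 and -1. It is applied to both transformations, with [shift2] graded by either of its
    coordinates. *)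
Lemma zpow_flow T (S : set X) (rel : int -> X -> X -> Prop) :
  (forall x, S x -> rel 0 x x) ->
  (forall a b x y z, rel a x y -> rel b y z -> rel (a + b) x z) ->
  (forall x, S x -> rel 1 x (T x) /\ S (T x)) ->
  (forall x, S x -> rel (- 1) x (mp_inv T x) /\ S (mp_inv T x)) ->
  forall k x, S x -> rel k x (zpow T k x).
Proof.
move=> r0 rD rT rV.
have main (f : X -> X) (e : int) (fS : forall x, S x -> rel e x (f x) /\ S (f x)) :
    forall n x, S x -> rel (e *+ n) x (iter n f x) /\ S (iter n f x).
  elim=> [|n IH] x Sx; first by split=> //; exact: r0.
  have [rn Sn] := IH x Sx; have [r1 S1] := fS _ Sn; split=> //.
  by rewrite mulrSr; apply: rD rn r1.
move=> [n|n] x Sx.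
  by have [] := main _ _ rT n x Sx; rewrite natz.
have [] := main _ _ rV n.+1 x Sx.
by rewrite NegzE mulNrn natz.
Qed.

Variables (V : aut mu) (f g : X -> X) (c : X -> int).
Hypotheses (fK : cancel f g) (gK : cancel g f).
Hypothesis fV : forall x, f x = zpow V (c x) x.
Hypothesis mc : forall k, measurable (c @^-1` [set k]).

(* On each piece, f is a fixed power of V. *)
Let piece (A : set X) (n : nat) : set X := [set x | A (f x) /\ pickle (c x) = n].

Let piece_zpow A n : measurable A ->
  [/\ measurable (piece A n), measurable (f @` piece A n) &
      mu (f @` piece A n) = mu (piece A n)].
Proof.
move=> mA; have [[z zn]|no] := pselect (exists z : int, pickle z = n); last first.
  have -> : piece A n = set0.
    by apply/seteqP; split=> x //= [_ xn]; apply: no; exists (c x).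
  by rewrite image_set0; split.
have mz (k : int) (B : set X) : measurable B -> measurable (zpow V k @^-1` B).
  by move=> mB; rewrite -[X in measurable X]setTI; apply: zpow_measurable.
have cz x : pickle (c x) = n <-> c x = z.
  by rewrite -zn; split=> [|->//]; apply: (pcan_inj pickleK).
have pE : piece A n = c @^-1` [set z] `&` zpow V z @^-1` A.
  apply/seteqP; split=> x /=; first by move=> [Ax /cz xz]; rewrite -{2}xz -fV.
  by move=> [xz]; rewrite -xz -fV => Ax; split=> //; apply/cz.
have mp : measurable (piece A n) by rewrite pE; apply: measurableI => //; exact: mz.
have fE : f @` piece A n = zpow V (- z) @^-1` piece A n.
  apply/seteqP; split=> [_ [x xp <-]|y yp] /=.
    by have [_ /cz xz] := xp; rewrite fV xz zpowK.
  exists (zpow V (- z) y) => //; have [_ /cz yz] := yp.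
  by rewrite fV yz -[X in zpow V X](opprK z) zpowK.
by rewrite fE; split; [|exact: mz|exact: zpow_preserves].
Qed.

Let preimage_pieces A : f @^-1` A = \bigcup_n piece A n.
Proof. by apply/seteqP; split=> [x Ax|x [n _ []//]]; exists (pickle (c x)). Qed.

Let image_pieces A : A = \bigcup_n f @` piece A n.
Proof.
apply/seteqP; split=> [x Ax|_ [n _ [x [Ax _] <-]]//].
by exists (pickle (c (g x))) => //; exists (g x); rewrite ?gK //; split;
  rewrite ?gK.
Qed.

(** A bijection that is piecewise a power of [V] lies in the full group of [V]: it preserves the
    measure on each of countably many pieces, and injectivity keeps the images of the pieces
    disjoint. *)
Lemma cocycle_aut : exists T : aut mu,
  (forall x, T x = f x) /\ (forall x, mp_inv T x = g x).
Proof.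
have mf : measurable_fun setT f.
  move=> _ A mA; rewrite setTI preimage_pieces; apply: bigcupT_measurable => n.
  by have [] := piece_zpow n mA.
have mg : measurable_fun setT g.
  move=> _ A mA; rewrite setTI.
  rewrite (_ : _ @^-1` _ = \bigcup_n f @` (A `&` piece setT n)); last first.
    apply/seteqP; split=> [x Ax|_ [n _ [x [Ax _] <-]]]; last by rewrite /= fK.
    by exists (pickle (c (g x))) => //; exists (g x); rewrite ?gK.
  apply: bigcupT_measurable => n; have [m1 m2 _] := piece_zpow n (@measurableT _ X).
  have [[z zn]|no] := pselect (exists z : int, pickle z = n); last first.
    rewrite (_ : A `&` _ = set0) ?image_set0 //.
    by apply/seteqP; split=> x //= [_ [_ xn]]; apply: no; exists (c x).
  have cz x : piece setT n x -> c x = z.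
    by move=> [_]; rewrite -zn; apply: (pcan_inj pickleK).
  rewrite (_ : _ @` _ = zpow V (- z) @^-1` (A `&` piece setT n)).
    by rewrite -[X in measurable X]setTI; apply: zpow_measurable => //;
      exact: measurableI.
  apply/seteqP; split=> [_ [x xp <-]|y yp] /=.
    by have [_ /cz xz] := xp; rewrite fV xz zpowK.
  exists (zpow V (- z) y) => //; have [_ /cz yz] := yp.
  by rewrite fV yz -[X in zpow V X](opprK z) zpowK.
have pf B : measurable B -> mu (f @^-1` B) = mu B.
  move=> mB; have mm n := piece_zpow n mB.
  rewrite [in RHS](image_pieces B) preimage_pieces !measure_semi_bigcup //.
  - by apply: eq_eseriesr => n _; have [_ _ E] := mm n; exact: esym E.
  - by move=> n; have [] := mm n.
  - apply/trivIsetP => i j _ _ ij;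
    rewrite -subset0 => _ [[x [_ xi] <-] [y [_ yj] /(can_inj fK) yx]].
    by move: ij; rewrite -xi -yj yx eqxx.
  - by apply: bigcupT_measurable => n; have [] := mm n.
  - by move=> n; have [] := mm n.
  - apply/trivIsetP => i j _ _ ij; rewrite -subset0 => x [[_ xi] [_ xj]].
    by move: ij; rewrite -xi -xj eqxx.
  - by apply: bigcupT_measurable => n; have [] := mm n.
by exists (MpIso fK gK mf mg pf).
Qed.

End Automorphisms.

(** * Transformations moving along a recoded odometer *)

Section Recoding.
Variables (r : nat -> nat) (good : nat -> nat -> Prop).
Variables (c off : nat -> nat -> nat).
Local Notation X := (odometer_space r).
Local Notation H := (radix_prod r).

(* good n u says that the digit u at position n stands for a copy, which starts
   at level off n u of the next tower. *)
Record recoding : Prop := Recoding {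
  recoding_inj : forall n k k', (k < H n)%N -> (k' < H n)%N ->
    c n k = c n k' -> k = k' ;
  recoding_step : forall n u k, good n u -> (k < H n)%N ->
    c n.+1 (u * H n + k)%N = (off n u + c n k)%N }.

Hypothesis cP : recoding.

(* The points whose later digits all stand for copies are those that belong to
   the n-th towers. *)
Definition settled (n : nat) (x : X) : Prop :=
  forall m, (n <= m)%N -> good m (x m).

(* y lies a levels above x in the T-towers and b levels above x in the
   V-towers, so that T^a x = y and V^b x = y. *)
Definition shift2 (a b : int) (x y : X) : Prop := exists n,
  [/\ settled n x, tail_eq n x y,
      (c n (index_of n y))%:Z = (c n (index_of n x))%:Z + a &
      (index_of n y)%:Z = (index_of n x)%:Z + b].

(* The set of regular points is invariant under tail equivalence, and on it
   both shifts act freely and transitively on each tail equivalence class. *)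
Definition regular (x : X) : Prop :=
  (forall a, exists b y, shift2 a b x y) /\
  (forall b, exists a y, shift2 a b x y).

Lemma settledW n m x : (n <= m)%N -> settled n x -> settled m x.
Proof. by move=> nm s i mi; apply: s; apply: leq_trans mi. Qed.

Lemma settled_tail n x y : tail_eq n x y -> settled n x -> settled n y.
Proof. by move=> t s m nm; rewrite -t //; exact: s. Qed.

(** A later digit is common to [x] and [y] and stands for a copy, so it adds one and the same amount
    to both recoded indices, and likewise to both indices. *)
Lemma recode_diff n m x y : (n <= m)%N -> settled n x -> tail_eq n x y ->
  (c m (index_of m y))%:Z - (c m (index_of m x))%:Z =
  (c n (index_of n y))%:Z - (c n (index_of n x))%:Z /\
  (index_of m y)%:Z - (index_of m x)%:Z =
  (index_of n y)%:Z - (index_of n x)%:Z.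
Proof.
move=> /subnKC <-; elim: (m - n)%N => [|d IH] s t; first by rewrite addn0.
have [<- <-] := IH s t; rewrite addnS !index_ofS.
have xg : good (n + d) (x (n + d)%N) by apply: s; rewrite leq_addr.
rewrite -(t (n + d)%N (leq_addr _ _)) !(recoding_step cP) ?index_of_lt //.
by split; lia.
Qed.

Lemma shift2_at n a b x y m : settled n x -> tail_eq n x y -> (n <= m)%N ->
  shift2 a b x y ->
  (c m (index_of m y))%:Z = (c m (index_of m x))%:Z + a /\
  (index_of m y)%:Z = (index_of m x)%:Z + b.
Proof.
move=> s t nm [l [s' t' ca ib]].
have [mxm mxl] : (m <= maxn m l)%N /\ (l <= maxn m l)%N by rewrite leq_maxl
  leq_maxr.
have [e1 e2] := recode_diff mxl s' t'.
have [e3 e4] := recode_diff mxm (settledW nm s) (tail_eqW nm t).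
by split; lia.
Qed.

Lemma shift2_large a b x y : shift2 a b x y -> exists n, forall m, (n <= m)%N ->
  [/\ settled m x, tail_eq m x y,
      (c m (index_of m y))%:Z = (c m (index_of m x))%:Z + a &
      (index_of m y)%:Z = (index_of m x)%:Z + b].
Proof.
move=> xy; have [n [s t _ _]] := xy; exists n => m nm.
have [ca ib] := shift2_at s t nm xy.
by split=> //; [exact: settledW s | exact: tail_eqW t].
Qed.

Lemma shift2_refl n x : settled n x -> shift2 0 0 x x.
Proof. by move=> s; exists n; split=> //; rewrite addr0. Qed.

Lemma shift2_sym a b x y : shift2 a b x y -> shift2 (- a) (- b) y x.
Proof.
move=> [n [s t ca ib]]; exists n; split; try by lia.
- exact: settled_tail s.
- exact: tail_eq_sym.
Qed.

Lemma shift2_trans a b a' b' x y z : shift2 a b x y -> shift2 a' b' y z ->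
  shift2 (a + a') (b + b') x z.
Proof.
move=> /shift2_large[n xy] /shift2_large[m yz].
have [s t e1 e2] := xy _ (leq_maxl n m).
have [_ t' e3 e4] := yz _ (leq_maxr n m).
by exists (maxn n m); split=> //; [exact: tail_eq_trans t t'|lia|lia].
Qed.

Lemma shift2_eql a b b' x y y' :
  shift2 a b x y -> shift2 a b' x y' -> y = y' /\ b = b'.
Proof.
move=> /shift2_large[n xy] /shift2_large[m xy'].
have [s t e1 e2] := xy _ (leq_maxl n m).
have [_ t' e3 e4] := xy' _ (leq_maxr n m).
have E : index_of (maxn n m) y = index_of (maxn n m) y'.
  by apply: (@recoding_inj cP (maxn n m)); rewrite ?index_of_lt //; lia.
split; last by lia.
exact: index_tail_inj (tail_eq_trans (tail_eq_sym t) t') E.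
Qed.

Lemma shift2_eqr a a' b x y y' :
  shift2 a b x y -> shift2 a' b x y' -> y = y' /\ a = a'.
Proof.
move=> /shift2_large[n xy] /shift2_large[m xy'].
have [s t e1 e2] := xy _ (leq_maxl n m).
have [_ t' e3 e4] := xy' _ (leq_maxr n m).
have E : index_of (maxn n m) y = index_of (maxn n m) y' by lia.
split; last by rewrite E in e1; lia.
exact: index_tail_inj (tail_eq_trans (tail_eq_sym t) t') E.
Qed.

Lemma shift2_det a a' b b' x y :
  shift2 a b x y -> shift2 a' b' x y -> a = a' /\ b = b'.
Proof.
move=> /shift2_large[n xy] /shift2_large[m xy'].
have [s t e1 e2] := xy _ (leq_maxl n m).
have [_ t' e3 e4] := xy' _ (leq_maxr n m).
by split; lia.
Qed.

Lemma regular_settled x : regular x -> exists n, settled n x.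
Proof. by move=> [/(_ 0)[b [y [n [s _ _ _]]]] _]; exists n. Qed.

Lemma regular_shift2 a b x y : shift2 a b x y -> regular x -> regular y.
Proof.
move=> xy [xa xb]; split=> [a'|b'].
  have [b' [z xz]] := xa (a + a'); exists (- b + b'), z.
  by have := shift2_trans (shift2_sym xy) xz; rewrite addKr.
have [a' [z xz]] := xb (b + b'); exists (- a + a'), z.
by have := shift2_trans (shift2_sym xy) xz; rewrite addKr.
Qed.

(* T is levelshift 1, its inverse is levelshift (- 1). *)
Definition levelshift (e : int) (x : X) : X :=
  if pselect (regular x) then xget x [set y | exists b, shift2 e b x y] else x.

Lemma levelshiftP e x : regular x -> exists b, shift2 e b x (levelshift e x).
Proof.
move=> rx; rewrite /levelshift; case: pselect => //= _.
have : exists y, exists b, shift2 e b x y by have [b [y xy]] := rx.1 e; exists y, b.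
exact: xgetPex.
Qed.

Lemma levelshift_irregular e x : ~ regular x -> levelshift e x = x.
Proof. by rewrite /levelshift; case: pselect. Qed.

Lemma levelshiftK e : cancel (levelshift e) (levelshift (- e)).
Proof.
move=> x; have [rx|nx] := pselect (regular x); last first.
  by rewrite !levelshift_irregular.
have [b xy] := levelshiftP e rx.
have [b' yz] := levelshiftP (- e) (regular_shift2 xy rx).
by have [->] := shift2_eql yz (shift2_sym xy).
Qed.

(* The cocycle of T over V; climb below is the cocycle of V over T. *)
Definition jump (x : X) : int :=
  if pselect (regular x) then xget 0 [set b | exists y, shift2 1 b x y] else 0.

Lemma jumpP x : regular x -> shift2 1 (jump x) x (levelshift 1 x).
Proof.
move=> rx; have [b xy] := levelshiftP 1 rx.
rewrite /jump; case: pselect => //= _.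
have : exists b, exists y, shift2 1 b x y by exists b, (levelshift 1 x).
by move=> /(xgetPex 0) [y /= xy']; have [-> _] := shift2_eql xy xy'.
Qed.

Lemma jump_irregular x : ~ regular x -> jump x = 0.
Proof. by rewrite /jump; case: pselect. Qed.

Definition climb (x : X) : int :=
  if pselect (regular x) then xget 0 [set a | exists y, shift2 a 1 x y] else 0.

Lemma climb_irregular x : ~ regular x -> climb x = 0.
Proof. by rewrite /climb; case: pselect. Qed.

(** As the index of [x] plus 1 is still below [H n], no carry leaves the first [n] digits, and the
    later ones agree. *)
Lemma add_shift2 a x y : shift2 a 1 x y -> y = add_with_carry x.
Proof.
move=> [n [_ t _ ib]]; have lt := index_of_lt n y.
have E : index_of n y = (index_of n x).+1 by lia.
have {t} : tail_eq n y (add_with_carry x).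
  move=> i ni; rewrite -t // /add_with_carry; case: ifP => // /forallP mx.
  have : [forall j : 'I_n, x j == ord_max].
    by apply/forallP => j; apply: (mx (widen_ord ni j)).
  by rewrite carry_index; lia.
move/index_tail_inj; apply.
by rewrite index_of_add E modn_small // -E.
Qed.

Lemma climbP x : regular x -> shift2 (climb x) 1 x (add_with_carry x).
Proof.
move=> rx; have [a [y xy]] := rx.2 1.
rewrite /climb; case: pselect => //= _.
have : exists a, exists y, shift2 a 1 x y by exists a, y.
by move=> /(xgetPex 0) [y' /= xy']; rewrite -(add_shift2 xy').
Qed.

Lemma measurable_settled n : measurable [set x | settled n x].
Proof.
rewrite (_ : [set _ | _] = \bigcap_(m in [set m | (n <= m)%N])
   [set x : X | [set k | good m (k %/ H m)] (index_of m.+1 x)]).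
  apply: bigcap_measurable; first by exists n => /=.
  by move=> m _; exact: measurable_index.
by apply/seteqP; split=> x /= s m nm; have := s m nm; rewrite /= index_of_div.
Qed.

Lemma measurable_shift2 a b : measurable [set x | exists y, shift2 a b x y].
Proof.
rewrite (_ : [set _ | _] = \bigcup_n ([set x | settled n x] `&`
   [set x : X | [set k | exists k', [/\ (k' < H n)%N,
     (c n k')%:Z = (c n k)%:Z + a & k'%:Z = k%:Z + b]] (index_of n x)])).
  apply: bigcupT_measurable => n.
  by apply: measurableI; [exact: measurable_settled|exact: measurable_index].
apply/seteqP; split=> [x [y [n [s t ca ib]]]|x [n _ [/= s [k' [k'H ca ib]]]]].
  exists n => //; split=> //=; exists (index_of n y).
  by rewrite index_of_lt.
exists (splice n k' x), n; rewrite index_of_splice //.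
by split=> //; exact: tail_eq_splice.
Qed.

Lemma measurable_regular : measurable [set x | regular x].
Proof.
rewrite (_ : [set _ | _] =
  (\bigcap_(a : int) \bigcup_(b : int) [set x | exists y, shift2 a b x y]) `&`
  (\bigcap_(b : int) \bigcup_(a : int) [set x | exists y, shift2 a b x y])).
  have U (F : int -> set X) : (forall a, measurable (F a)) -> measurable
    (\bigcup_a F a).
    by apply: countable_bigcupT_measurable; exact: countableP.
  have I (F : int -> set X) : (forall a, measurable (F a)) -> measurable
    (\bigcap_a F a).
    move=> mF; rewrite -[\bigcap_a F a]setCK setC_bigcap; apply: measurableC.
    by apply: U => a; exact: measurableC.
  by apply: measurableI; apply: I => a; apply: U => b; exact: measurable_shift2.
apply/seteqP; split=> x /=.
  move=> [xa xb]; split=> [a _|b _].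
    by have [b xy] := xa a; exists b.
  by have [a xy] := xb b; exists a.
move=> [xa xb]; split=> [a|b].
  by have [b _ xy] := xa a I; exists b.
by have [a _ xy] := xb b I; exists a.
Qed.

Let measurable_cocycle (f : X -> int) (g : int -> int -> X -> Prop) k :
  measurable [set x | g k k x] ->
  (forall x, ~ regular x -> f x = 0) ->
  (forall x, regular x -> f x = k <-> g k k x) ->
  measurable (f @^-1` [set k]).
Proof.
move=> mg f0 fg; have mr := measurable_regular.
rewrite (_ : _ @^-1` _ = ([set x | regular x] `&` [set x | g k k x]) `|`
   (~` [set x | regular x] `&` [set x | 0 = k])).
  apply: measurableU; first exact: measurableI.
  apply: measurableI; first exact: measurableC.
  have [->|/eqP k0] := eqVneq k 0.
    by rewrite (_ : [set _ | _] = setT) //; apply/seteqP; split.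
  by rewrite (_ : [set _ | _] = set0) //; apply/seteqP; split=> // x /= /esym.
apply/seteqP; split=> x /=.
  have [rx|nx] := pselect (regular x); last by rewrite f0 //; right.
  by move=> /(fg _ rx); left.
by case=> -[rx]; [move=> /(fg _ rx) | rewrite f0].
Qed.

Lemma measurable_jump k : measurable (jump @^-1` [set k]).
Proof.
apply: (@measurable_cocycle _ (fun k _ x => exists y, shift2 1 k x y)).
- exact: measurable_shift2.
- exact: jump_irregular.
- move=> x rx; split=> [<-|[y xy]]; first by exists (levelshift 1 x); exact: jumpP.
  by have [_ ->] := shift2_eql xy (jumpP rx).
Qed.

Lemma measurable_climb k : measurable (climb @^-1` [set k]).
Proof.
apply: (@measurable_cocycle _ (fun k _ x => exists y, shift2 k 1 x y)).
- exact: measurable_shift2.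
- exact: climb_irregular.
- move=> x rx; split=> [<-|[y xy]]; first by exists (add_with_carry x);
  exact: climbP.
  by have [_ ->] := shift2_eqr xy (climbP rx).
Qed.

Section Transformation.
Variables (R : realType) (P : probability X R) (unif : product_of_uniforms P).
Let V := odometer unif.

Lemma zpow_odometer k x : regular x -> exists a, shift2 a k x (zpow V k x).
Proof.
move: k x; apply: (@zpow_flow _ _ _ _ V _ (fun k x y => exists a, shift2 a k x y)).
- by move=> x /regular_settled[n s]; exists 0; exact: shift2_refl s.
- by move=> a b x y z [a1 xy] [b1 yz]; exists (a1 + b1); exact: shift2_trans xy yz.
- move=> x rx; have xy := climbP rx.
  by split; [exists (climb x) | exact: regular_shift2 xy rx].
- move=> x rx; have [a [y xy]] := rx.2 (- 1).
  have E : mp_inv V x = y.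
    have := shift2_sym xy; rewrite opprK => /add_shift2 ->.
    exact: add_with_carryK.
  by rewrite E; split; [exists a | exact: regular_shift2 xy rx].
Qed.

Lemma zpow_odometerE a b x y : regular x -> shift2 a b x y -> zpow V b x = y.
Proof.
by move=> rx xy; have [a' xz] := zpow_odometer b rx; have [->] := shift2_eqr xz xy.
Qed.

(** [jump] exhibits the level shift as piecewise a power of [V]; fixing the irregular points makes
    it an everywhere defined bijection. *)
Lemma levelshift_aut : exists T : aut P,
  (forall x, T x = levelshift 1 x) /\ (forall x, mp_inv T x = levelshift (- 1) x).
Proof.
apply: (@cocycle_aut _ _ _ P V _ _ jump).
- exact: levelshiftK.
- by have := @levelshiftK (- 1); rewrite opprK.
- move=> x; have [rx|nx] := pselect (regular x).
    by rewrite (zpow_odometerE rx (jumpP rx)).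
  by rewrite levelshift_irregular // jump_irregular.
- exact: measurable_jump.
Qed.

Variable T : aut P.
Hypotheses (TE : forall x, T x = levelshift 1 x)
  (TVE : forall x, mp_inv T x = levelshift (- 1) x).

Lemma zpow_levelshift k x : regular x -> exists b, shift2 k b x (zpow T k x).
Proof.
move: k x; apply: (@zpow_flow _ _ _ _ T _ (fun k x y => exists b, shift2 k b x y)).
- by move=> x /regular_settled[n s]; exists 0; exact: shift2_refl s.
- by move=> a b x y z [a1 xy] [b1 yz]; exists (a1 + b1); exact: shift2_trans xy yz.
- move=> x rx; have [b xy] := levelshiftP 1 rx; rewrite TE.
  by split; [exists b | exact: regular_shift2 xy rx].
- move=> x rx; have [b xy] := levelshiftP (- 1) rx; rewrite TVE.
  by split; [exists b | exact: regular_shift2 xy rx].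
Qed.

Lemma zpow_levelshiftE a b x y : regular x -> shift2 a b x y -> zpow T a x = y.
Proof.
by move=> rx xy; have [a' xz] := zpow_levelshift a rx;
  have [->] := shift2_eql xz xy.
Qed.

Hypothesis ae_regular : {ae P, forall x, regular x}.

Lemma levelshift_aperiodic : aperiodic T.
Proof.
apply: filterS ae_regular => x rx n n0 E.
have [b xy] := zpow_levelshift (Posz n) rx; rewrite /= E in xy.
have [m s] := regular_settled rx.
by have [] := shift2_det xy (shift2_refl s); lia.
Qed.

Definition id_iso : mp_iso P P :=
  MpIso (fun=> erefl) (fun=> erefl) (@measurable_id _ _ _)
    (@measurable_id _ _ _) (fun _ _ => erefl).

Lemma levelshift_same_orbits : same_orbits T V id_iso.
Proof.
apply: filterS ae_regular => x rx; apply/seteqP; split=> _ [k _ <-] /=.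
  have [b xy] := zpow_levelshift k rx; exists b => //.
  exact: zpow_odometerE rx xy.
have [a xy] := zpow_odometer k rx; exists a => //.
exact: zpow_levelshiftE rx xy.
Qed.

Lemma levelshift_cocycles : cocycles T V id_iso jump climb.
Proof.
split; [exact: measurable_jump | exact: measurable_climb | |].
  apply: filterS ae_regular => x rx /=; rewrite TE.
  by rewrite (zpow_odometerE rx (jumpP rx)).
apply: filterS ae_regular => x rx /=.
by rewrite (zpow_levelshiftE rx (climbP rx)).
Qed.

End Transformation.

End Recoding.

Lemma odometer_aperiodic (R : realType) (r : nat -> nat)
  (P : probability (odometer_space r) R) (unif : product_of_uniforms P) :
  aperiodic (odometer unif).
Proof. by apply: aeW => x n; exact: iter_add_with_carry_neq. Qed.

(** * Integrability and almost sure regularity *)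

(** Only the cube root is increasing, not [phi]: the finitely many integers below the asymptotic
    range are therefore absorbed into the constant. *)
Lemma little_o_cube_root (R : realType) (phi : R -> R) :
  phi =o_ (pinfty_nbhs R) (fun t : R => t `^ (3%:R^-1)) ->
  exists2 A : R, 0 <= A &
    forall k E, (k <= E)%N -> (0 < E)%N -> phi k%:R <= A * (E%:R `^ (3%:R^-1)).
Proof.
move=> /eqoP /(_ 1 ltr01) [M [_ phiM]].
pose N := (Num.truncn `|M|).+1.
pose A := \sum_(k < N) `|phi k%:R|.
have A0 : 0 <= A by apply: sumr_ge0.
exists (A + 1); first by rewrite addr_ge0.
move=> k E kE E0; have E1 : 1 <= E%:R `^ (3%:R^-1) :> R.
  apply: (@le_trans _ _ (1 `^ (3%:R^-1))); first by rewrite powR1.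
  by rewrite ge0_ler_powR ?nnegrE ?invr_ge0 // ler1n.
have [kN|Nk] := ltnP k N.
  apply: le_trans (ler_norm _) _; apply: (@le_trans _ _ A).
    by rewrite /A (bigD1 (Ordinal kN)) //= lerDl sumr_ge0.
  by nra.
have Mk : M < k%:R.
  apply: le_lt_trans (ler_norm _) _; apply: lt_le_trans (truncnS_gt _) _.
  by rewrite ler_nat.
have := phiM _ Mk; rewrite mul1r [leRHS]ger0_norm ?powR_ge0 // => h.
apply: le_trans (ler_norm _) _; apply: le_trans h _.
have : k%:R `^ (3%:R^-1) <= E%:R `^ (3%:R^-1) :> R.
  by rewrite ge0_ler_powR ?nnegrE ?invr_ge0 // ler_nat.
by nra.
Qed.

Section Layers.
Variables (R : realType) (d : measure_display) (X : measurableType d).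
Variable mu : probability X R.

(** [O n] stands for the points decided at stage [n]. The layer new at stage [n.+1] has measure at
    most [w n] and values at most [e n]; the points that are never decided form a separate layer,
    numbered 0. *)
Lemma integral_layers (f : X -> R) (O : nat -> set X) (A : R) (e w : nat -> R) :
  measurable_fun setT f -> (forall x, 0 <= f x) ->
  (forall n, measurable (O n)) -> (forall n, O n `<=` O n.+1) -> O 0%N = set0 ->
  0 <= A -> (forall n, 0 <= e n) ->
  (forall x, (forall n, ~ O n x) -> f x <= A) ->
  (forall n x, O n.+1 x -> f x <= e n) ->
  (forall n, mu (O n.+1 `\` O n) <= (w n)%:E)%E ->
  (\sum_(0 <= n <oo) (w n * e n)%:E < +oo)%E ->
  (\int[mu]_x (f x)%:E < +oo)%E.
Proof.
move=> mf f0 mO Om O0 A0 e0 fA fe wO ws.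
pose F n := if n is m.+1 then O m.+1 `\` O m else ~` \bigcup_n O n.
have Oi n m : (n <= m)%N -> O n `<=` O m.
  move=> /subnKC <-; elim: (m - n)%N => [|k IH]; first by rewrite addn0.
  by rewrite addnS; exact: subset_trans IH (Om _).
have FT : setT = \bigcup_n F n.
  apply/seteqP; split=> // x _.
  have [[n On]|no] := pselect (exists n, O n x); last first.
    by exists 0%N => // -[n _ On]; apply: no; exists n.
  have ex : exists n, `[< O n x >] by exists n; apply/asboolP.
  case: (ex_minnP ex) => -[|m] /asboolP Om1 min.
    by rewrite O0 in Om1.
  exists m.+1 => //; split=> // Omx.
  by have := min m (asboolT Omx); rewrite ltnn.
have mF n : measurable (F n).
  case: n => [|n]; last exact: measurableD.
  by apply: measurableC; exact: bigcupT_measurable.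
have tF : trivIset setT F.
  apply/trivIsetP => i j _ _; wlog ij : i j / (i < j)%N.
    move=> W; rewrite neq_ltn => /orP[lt|lt]; first by apply: W => //;
      rewrite ltn_eqF.
    by rewrite setIC; apply: W => //; rewrite ltn_eqF.
  move=> _; case: j ij => // j; rewrite ltnS => ij; rewrite -subset0 => x.
  case: i ij => [|i] ij /= [Fi [Oj nOj]]; first by apply: Fi; exists j.+1.
  by apply: nOj; case: Fi => + _; exact: Oi.
have mfE : measurable_fun setT (fun x => (f x)%:E) by exact/measurable_EFinP.
have -> : (\int[mu]_x (f x)%:E = \sum_(0 <= n <oo) \int[mu]_(x in F n) (f x)%:E)%E.
  rewrite [X in integral _ X _]FT; apply: ge0_integral_bigcup => //; rewrite -FT //.
  by move=> x _; rewrite lee_fin.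
have bd n (a : R) : 0 <= a -> (forall x, F n x -> f x <= a) ->
    (\int[mu]_(x in F n) (f x)%:E <= a%:E * mu (F n))%E.
  move=> a0 fa; rewrite -integral_cst //; apply: ge0_le_integral => //.
  - by move=> x _; rewrite lee_fin.
  - exact: measurable_funTS.
have b0 : (\int[mu]_(x in F 0%N) (f x)%:E <= A%:E)%E.
  apply: (le_trans (bd 0%N A A0 _)).
    by move=> x Fx; apply: fA => n On; apply: Fx; exists n.
  by rewrite -[leRHS]mule1 lee_wpmul2l // ?lee_fin // probability_le1.
have b1 n : (\int[mu]_(x in F n.+1) (f x)%:E <= (w n * e n)%:E)%E.
  apply: (le_trans (bd n.+1 (e n) (e0 n) _)); first by move=> x [/fe].
  by rewrite EFinM muleC; apply: lee_wpmul2r; rewrite ?lee_fin // wO.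
have i0 n : (0 <= \int[mu]_(x in F n) (f x)%:E)%E.
  by apply: integral_ge0 => x _; rewrite lee_fin.
rewrite nneseries_recl //; apply: lte_add_pinfty.
  exact: le_lt_trans b0 (ltry _).
rewrite -nneseries_addn; last by move=> i; exact: i0.
by apply: le_lt_trans ws; apply: lee_nneseries => // n _; rewrite addn1.
Qed.

End Layers.

Definition missing (f : nat -> nat) (N : nat) (a : int) : seq nat :=
  [seq k <- iota 0 N |
    ~~ `[< exists2 k', (k' < N)%N & (f k')%:Z = (f k)%:Z + a >]].

(** The values [f k + a] for missing [k] avoid the range of [f], and together with this range they
    are distinct integers between [- |a|] and [M + |a|]. *)
Lemma size_missing (f : nat -> nat) N M a :
  (forall k, (k < N)%N -> (f k < M)%N) ->
  (forall k k', (k < N)%N -> (k' < N)%N -> f k = f k' -> k = k') ->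
  (size (missing f N a) + N <= M + 2 * absz a)%N.
Proof.
move=> fM finj; pose s := absz a.
pose L1 := [seq absz ((f k)%:Z + a + s%:Z) | k <- missing f N a].
pose L2 := [seq (f k + s)%N | k <- iota 0 N].
have mN k : k \in missing f N a -> (k < N)%N.
  by rewrite mem_filter mem_iota => /andP[].
have -> : size (missing f N a) = size L1 by rewrite size_map.
have sL2 : size L2 = N by rewrite size_map size_iota.
rewrite -[X in (_ + X)%N]sL2 -size_cat.
rewrite -(size_iota 0 (M + _)); apply: uniq_leq_size.
  rewrite cat_uniq !map_inj_in_uniq ?iota_uniq ?filter_uniq ?iota_uniq //.
  - rewrite andbT; apply/hasPn => y /mapP[k]; rewrite mem_iota => /= kN ->.
    apply/mapP => -[k0]; rewrite mem_filter => /andP[/asboolPn no _] E.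
    by apply: no; exists k => //; lia.
  - move=> k k'; rewrite !mem_iota /= => kN k'N E; apply: finj => //; lia.
  - move=> k k' /mN kN /mN k'N E; apply: finj => //; lia.
move=> x; rewrite mem_cat mem_iota /= add0n => /orP[] /mapP[k].
  by move=> /mN /fM fk ->; lia.
by rewrite mem_iota /= => /fM fk ->; lia.
Qed.

(** * Measure of the points whose shift is undecided at a given stage *)

Section Estimates.
Variables (R : realType) (r : nat -> nat) (P : probability (odometer_space r) R).
Hypothesis unif : product_of_uniforms P.
Local Notation X := (odometer_space r).
Local Notation H := (radix_prod r).

Lemma measure_index_seq n (s : seq nat) :
  (P [set x | index_of n x \in s] <= ((size s)%:R / (H n)%:R)%:E)%E.
Proof.
elim: s => [|k s IH].
  rewrite (_ : [set _ | _] = set0) ?measure0 ?mul0r //.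
  by apply/seteqP; split=> x //=; rewrite in_nil.
rewrite (_ : [set _ | _] = [set x | index_of n x = k] `|` [set x | index_of n x
  \in s]).
  apply: le_trans (measureU2 _ _ _) _.
  - exact: (@measurable_index r n [set k]).
  - exact: (@measurable_index r n [set l | l \in s]).
  rewrite /= -natr1 mulrDl mul1r EFinD [leLHS]addeC; apply: leeD; first exact: IH.
  exact: uniform_index_le.
by apply/seteqP; split=> x /=; rewrite inE; [case/predU1P; [left|right]|
  case=> [->|->]; rewrite ?eqxx ?orbT].
Qed.

Lemma measure_digit (g : nat -> Prop) n q (pos : nat -> nat) :
  (forall i, (i < q)%N -> (pos i < (r n).+2)%N /\ g (pos i)) ->
  (forall i j, (i < q)%N -> (j < q)%N -> pos i = pos j -> i = j) ->
  (P [set x : X | ~ g (x n)] <= (((r n).+2 - q)%:R / (r n).+2%:R)%:E)%E.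
Proof.
move=> pg pinj; pose s := [seq k <- iota 0 (H n.+1) | ~~ `[< g (k %/ H n)%N >]].
apply: (@le_trans _ _ (P [set x | index_of n.+1 x \in s])).
  apply: le_measure; rewrite ?inE.
  - rewrite (_ : [set _ | _] = [set x : X | [set k | ~ g (k %/ H n)%N]
    (index_of n.+1 x)]).
      exact: measurable_index.
    by apply/seteqP; split=> x /=; rewrite index_of_div.
  - exact: (@measurable_index r n.+1 [set k | k \in s]).
  - move=> x /= gx; rewrite mem_filter mem_iota index_of_lt andbT index_of_div.
    by rewrite andbT; apply/asboolPn.
apply: le_trans (measure_index_seq _ _) _; rewrite lee_fin.
have H0 := radix_prod_gt0 r n.
suff sz : (size s + q * H n <= (r n).+2 * H n)%N.
  rewrite ler_pdivrMr ?ltr0n // mulrAC ler_pdivlMr ?ltr0n // -!natrM ler_nat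
    radix_prodS.
  move: sz; move: (size s) (H n) H0 (_.+2) => a b b0 p; nia.
pose L := [seq (pos i * H n + k)%N | i <- iota 0 q, k <- iota 0 (H n)].
have <- : size L = (q * H n)%N by rewrite size_allpairs !size_iota.
rewrite -size_cat -radix_prodS -[X in (_ <= X)%N](size_iota 0);
  apply: uniq_leq_size.
  rewrite cat_uniq filter_uniq ?iota_uniq //=; apply/andP; split.
    apply/hasPn => y /allpairsP[[i k] /= []]; rewrite !mem_iota /= => iq kH ->.
    rewrite mem_filter divnMDl // divn_small // addn0.
    by rewrite asboolT //; have [] := pg _ iq.
  apply: allpairs_uniq; rewrite ?iota_uniq // => -[i k] [j l].
  move=> /allpairsP[[a b] /= [+ + [-> ->]]] /allpairsP[[a' b'] /= [+ + [-> ->]]].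
  rewrite !mem_iota /= !add0n => aq bH aq' bH' E.
  have pp : pos a = pos a'.
    by have := congr1 (divn^~ (H n)) E;
      rewrite /= !divnMDl // !divn_small // !addn0.
  by congr pair; [exact: pinj | move: E; rewrite pp => /addnI].
move=> x; rewrite mem_cat => /orP[|/allpairsP[[i k] /= []]];
  first by rewrite mem_filter => /andP[].
rewrite !mem_iota /= !add0n => iq kH ->; have [pi _] := pg _ iq.
by rewrite radix_prodS; move: pi kH; move: (pos i) (H n) (_.+2); nia.
Qed.

Variables (good : nat -> nat -> Prop) (beta : nat -> R).
Local Notation settled := (@settled r good).
Hypothesis beta_good : forall n, (P [set x : X | ~ good n (x n)] <= (beta n)%:E)%E.
Hypothesis beta_sum : (\sum_(0 <= n <oo) (beta n)%:E < +oo)%E.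

Let beta_ge0 n : 0 <= beta n.
Proof. by rewrite -lee_fin; apply: le_trans (beta_good n); exact: measure_ge0. Qed.

Let m_good n : measurable [set x : X | ~ good n (x n)].
Proof.
rewrite (_ : [set _ | _] = [set x : X | [set k | ~ good n (k %/ H n)%N]
  (index_of n.+1 x)]).
  exact: measurable_index.
by apply/seteqP; split=> x /=; rewrite index_of_div.
Qed.

Let tail_beta n := (\sum_(n <= k <oo) (beta k)%:E)%E.

(** Union bound over the later digits, as in the Borel-Cantelli lemma. *)
Let unsettled_le n : (P (~` [set x | settled n x]) <= tail_beta n)%E.
Proof.
pose F k := [set x : X | ~ good (k + n)%N (x (k + n)%N)].
apply: (@le_trans _ _ (\sum_(0 <= k <oo) P (F k))%E).
  apply: measure_sigma_subadditive => [k||x /= nx].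
  - exact: m_good.
  - by apply: measurableC; exact: measurable_settled.
  - apply: contrapT => no; apply: nx => m nm; apply: contrapT => ng; apply: no.
    by exists (m - n)%N => //; rewrite /F /= subnK.
rewrite /tail_beta -(@nneseries_addn _ (fun k => (beta k)%:E)).
  by apply: lee_nneseries => // k _; exact: beta_good.
by move=> k; rewrite lee_fin.
Qed.

Variables (f : nat -> nat -> nat) (a : int) (M : nat -> nat).
Hypothesis f_inj : forall n k k', (k < H n)%N -> (k' < H n)%N ->
  f n k = f n k' -> k = k'.
Hypothesis f_lt : forall n k, (0 < n)%N -> (k < H n)%N -> (f n k < M n)%N.
Hypothesis beta_level : forall n, (0 < n)%N ->
  ((M n - H n).+1)%:R / (H n)%:R <= beta n.

(** The point [a] levels above [x] can be read off the n-th tower, levels being numbered by [f].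
    Taking for [f] the recoding or the identity treats T and V at once. *)
Definition determined n : set X :=
  [set x | settled n x /\ index_of n x \notin missing (f n) (H n) a].

Lemma measurable_determined n : measurable (determined n).
Proof.
apply: measurableI; first exact: measurable_settled.
exact: (@measurable_index r n [set k | k \notin missing (f n) (H n) a]).
Qed.

Lemma determinedP n x : determined n x <-> settled n x /\
  exists2 k', (k' < H n)%N & (f n k')%:Z = (f n (index_of n x))%:Z + a.
Proof.
rewrite /determined /= mem_filter mem_iota /= add0n index_of_lt andbT negbK.
by split=> -[s /asboolP].
Qed.

Let missing_le n : (0 < n)%N ->
  (size (missing (f n) (H n) a))%:R / (H n)%:R <= (1 + 2 * absz a)%N%:R * beta n.
Proof.
move=> n0; apply: (@le_trans _ _ ((1 + 2 * absz a)%N%:R * ((M n - H n).+1%:R /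
  (H n)%:R))).
  rewrite mulrA ler_pM2r ?invr_gt0 ?ltr0n // -natrM ler_nat.
  have := @size_missing (f n) (H n) (M n) a (fun k => @f_lt n k n0) (@f_inj n).
  by move: (size _) => z; nia.
by rewrite ler_wpM2l // beta_level.
Qed.

(** A point decided at stage [n.+1] but not at stage [n] has a digit at position [n] that is no
    copy, or an index whose shift misses the n-th tower. Stage 0 is covered by the trivial bound
    1. *)
Lemma determined_layer n : 1 <= beta 0%N ->
  (P (determined n.+1 `\` determined n) <= ((2 + 2 * absz a)%N%:R * beta n)%:E)%E.
Proof.
move=> b0; have md := measurableD (measurable_determined n.+1)
  (measurable_determined n).
case: (posnP n) => [n0|n0].
  apply: (@le_trans _ _ 1%E); first exact: probability_le1.
  rewrite lee_fin n0 -[X in X <= _]mul1r ler_pM // ler1n; lia.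
apply: (@le_trans _ _ (P ([set x : X | ~ good n (x n)] `|`
    [set x | index_of n x \in missing (f n) (H n) a]))).
  apply: le_measure; rewrite ?inE //.
    apply: measurableU => //.
    exact: (@measurable_index r n [set k | k \in missing (f n) (H n) a]).
  move=> x [[s _] nd]; have [gx|ngx] := pselect (good n (x n)); last by left.
  right => /=; apply: contrapT => /negP ni; apply: nd; split=> // m.
  by rewrite leq_eqVlt => /predU1P[<-//|]; exact: s.
apply: le_trans (measureU2 _ _ _) _ => //.
  exact: (@measurable_index r n [set k | k \in missing (f n) (H n) a]).
rewrite (_ : _ * _ = beta n + (1 + 2 * absz a)%N%:R * beta n); last first.
  by rewrite addSn -natr1 mulrDl mul1r addrC.
rewrite EFinD; apply: leeD; first exact: beta_good.
by apply: le_trans (measure_index_seq _ _) _; rewrite lee_fin missing_le.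
Qed.

(** For every [n > 0], a point that is never decided is unsettled at stage [n] or has a missing
    index there; both events are controlled by the tail of a convergent series. *)
Lemma determined_ae : P (~` \bigcup_n determined n) = 0%E.
Proof.
set B := ~` _; have mB : measurable B.
  by apply: measurableC; apply: bigcupT_measurable => n;
    exact: measurable_determined.
set K := ((1 + 2 * absz a)%N%:R)%:E : \bar R.
have bd n : (0 < n)%N -> (P B <= tail_beta n + K * tail_beta n)%E.
  move=> n0; apply: (@le_trans _ _ (P (~` [set x | settled n x] `|`
      [set x | index_of n x \in missing (f n) (H n) a]))).
    apply: le_measure; rewrite ?inE //.
      apply: measurableU; first by apply: measurableC; exact: measurable_settled.
      exact: (@measurable_index r n [set k | k \in missing (f n) (H n) a]).
    move=> x Bx /=; have [s|ns] := pselect (settled n x); last by left.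
    by right; apply: contrapT => /negP ni; apply: Bx; exists n.
  apply: le_trans (measureU2 _ _ _) _.
  - by apply: measurableC; exact: measurable_settled.
  - exact: (@measurable_index r n [set k | k \in missing (f n) (H n) a]).
  apply: leeD; first exact: unsettled_le.
  apply: le_trans (measure_index_seq _ _) _.
  apply: (@le_trans _ _ ((1 + 2 * absz a)%N%:R * beta n)%:E).
    by rewrite lee_fin missing_le.
  rewrite EFinM lee_wpmul2l // ?lee_fin //.
  rewrite /tail_beta -(@nneseries_addn _ (fun k => (beta k)%:E));
    last by move=> k; rewrite lee_fin.
  rewrite nneseries_recl //; last by move=> k _; rewrite lee_fin.
  rewrite add0n; apply: leeDl; apply: nneseries_ge0 => k _ _.
  by rewrite lee_fin.
have t0 : tail_beta n @[n --> \oo] --> 0%E.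
  by apply: nneseries_tail_cvg => // k _; rewrite lee_fin.
have t1 : (tail_beta n + K * tail_beta n)%E @[n --> \oo] --> 0%E.
  rewrite -[X in _ --> X]adde0; apply: cvgeD => //.
  by rewrite -[X in _ --> X](mule0 K); apply: cvgeZl.
apply/eqP; rewrite eq_le measure_ge0 andbT.
apply: cvge_ge t1.
by exists 1%N => // n /= n0; exact: bd.
Qed.

End Estimates.

Lemma measurable_int_comp (R : realType) d (X : measurableType d)
    (j : X -> int) (g : int -> R) :
  (forall k, measurable (j @^-1` [set k])) -> measurable_fun setT (g \o j).
Proof.
move=> mj _ A _; rewrite setTI.
rewrite (_ : _ @^-1` _ = \bigcup_(k : int) (if `[< A (g k) >] then j @^-1` [set
  k] else set0)).
  apply: countable_bigcupT_measurable; first exact: countableP.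
  by move=> k; case: ifP.
apply/seteqP; split=> [x Ax|x [k _]].
  by exists (j x) => //; rewrite asboolT.
by case: ifP => // /asboolP Ak /= jk; rewrite /= jk.
Qed.

(** * Almost sure regularity and integrability of both cocycles *)

Section Integrals.
Variables (R : realType) (r : nat -> nat) (P : probability (odometer_space r) R).
Hypothesis unif : product_of_uniforms P.
Local Notation X := (odometer_space r).
Local Notation H := (radix_prod r).
Variables (good : nat -> nat -> Prop) (c off : nat -> nat -> nat).
Variables (beta e : nat -> R) (h D : nat -> nat).
Local Notation settled := (@settled r good).
Local Notation regular := (@regular r good c).
Local Notation shift2 := (@shift2 r good c).
Local Notation determined := (@determined r good).

Hypothesis cP : recoding r good c off.
Hypothesis beta_good : forall n, (P [set x : X | ~ good n (x n)] <= (beta n)%:E)%E.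
Hypothesis beta_e_sum : (\sum_(0 <= n <oo) (beta n * e n)%:E < +oo)%E.
Hypothesis e_ge1 : forall n, 1 <= e n.
Hypothesis c_lt : forall n k, (0 < n)%N -> (k < H n)%N -> (c n k < h n)%N.
Hypothesis beta_level : forall n, (0 < n)%N ->
  ((h n - H n).+1)%:R / (H n)%:R <= beta n.
(* The towers of the odometer itself are recoded by the identity. *)
Let id_code : nat -> nat -> nat := fun _ k => k.

Let beta_ge0 n : 0 <= beta n.
Proof. by rewrite -lee_fin; apply: le_trans (beta_good n); exact: measure_ge0. Qed.

Let beta_sum : (\sum_(0 <= n <oo) (beta n)%:E < +oo)%E.
Proof.
apply: le_lt_trans beta_e_sum; apply: lee_nneseries => n _; rewrite lee_fin //.
by rewrite -{1}[beta n]mulr1 ler_wpM2l.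
Qed.

Let id_inj n k k' : (k < H n)%N -> (k' < H n)%N -> id_code n k = id_code n k'
  -> k = k'.
Proof. by []. Qed.

Let id_lt n k : (0 < n)%N -> (k < H n)%N -> (id_code n k < H n)%N.
Proof. by []. Qed.

Let beta_id n : (0 < n)%N -> ((H n - H n).+1)%:R / (H n)%:R <= beta n.
Proof.
move=> n0; apply: le_trans (beta_level n0).
by rewrite ler_pM2r ?invr_gt0 ?ltr0n // ler_nat subnn.
Qed.

Let determined_splice f a n x : determined f a n x ->
  exists k', [/\ (k' < H n)%N, settled n x, tail_eq n x (splice n k' x),
     index_of n (splice n k' x) = k' & (f n k')%:Z = (f n (index_of n x))%:Z + a].
Proof.
move=> /determinedP[s [k' k'n E]]; exists k'; split=> //.
  exact: tail_eq_splice.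
exact: index_of_splice.
Qed.

Let determined_c a n x : determined c a n x -> exists b y, shift2 a b x y.
Proof.
move=> /determined_splice[k' [k'n s t ik E]].
by exists (k'%:Z - (index_of n x)%:Z), (splice n k' x), n; split; rewrite ?ik //;
  lia.
Qed.

Let determined_id b n x : determined id_code b n x -> exists a y, shift2 a b x y.
Proof.
move=> /determined_splice[k' [k'n s t ik E]].
exists ((c n k')%:Z - (c n (index_of n x))%:Z), (splice n k' x), n.
by split; rewrite ?ik //; lia.
Qed.

Let shift2_determined_c a b x y : shift2 a b x y -> exists n, determined c a n x.
Proof.
move=> [n [s t ca ib]]; exists n; apply/determinedP; split=> //.
by exists (index_of n y); rewrite ?index_of_lt.
Qed.

Let shift2_determined_id a b x y : shift2 a b x y -> exists n, determined
  id_code b n x.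
Proof.
move=> [n [s t ca ib]]; exists n; apply/determinedP; split=> //.
by exists (index_of n y); rewrite ?index_of_lt.
Qed.

Let determined_mono_c a n x : determined c a n x -> determined c a n.+1 x.
Proof.
move=> dx; have [k' [k'n s t ik E]] := determined_splice dx.
set y := splice n k' x in t ik.
have xy : shift2 a (k'%:Z - (index_of n x)%:Z) x y.
  by exists n; split; rewrite ?ik //; lia.
have [ca _] := shift2_at cP s t (leqnSn n) xy.
apply/determinedP; split; first exact: settledW s.
by exists (index_of n.+1 y); rewrite ?index_of_lt.
Qed.

Let determined_mono_id b n x : determined id_code b n x -> determined id_code b
  n.+1 x.
Proof.
move=> dx; have [k' [k'n s t ik E]] := determined_splice dx.
set y := splice n k' x in t ik.
have xy : shift2 ((c n k')%:Z - (c n (index_of n x))%:Z) b x y.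
  by exists n; split; rewrite ?ik //; lia.
have [_ ib] := shift2_at cP s t (leqnSn n) xy.
apply/determinedP; split; first exact: settledW s.
by exists (index_of n.+1 y); rewrite ?index_of_lt.
Qed.

Let ae_determined f M a :
  (forall n k k', (k < H n)%N -> (k' < H n)%N -> f n k = f n k' -> k = k') ->
  (forall n k, (0 < n)%N -> (k < H n)%N -> (f n k < M n)%N) ->
  (forall n, (0 < n)%N -> ((M n - H n).+1)%:R / (H n)%:R <= beta n) ->
  {ae P, forall x, exists n, determined f a n x}.
Proof.
move=> fi fl bl.
have := determined_ae unif beta_good beta_sum a fi fl bl.
move=> P0; exists (~` \bigcup_n determined f a n); split=> //.
  apply: measurableC; apply: bigcupT_measurable => n; exact: measurable_determined.
by move=> x /= nx [n _ dx]; apply: nx; exists n.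
Qed.

Let ae_int (Q : int -> X -> Prop) :
  (forall k, {ae P, forall x, Q k x}) -> {ae P, forall x, forall k, Q k x}.
Proof.
move=> aeQ; have := ae_foralln (fun n => aeQ (Posz n)).
apply: filterS2 (ae_foralln (fun n => aeQ (Negz n))) => x Qn Qp [n|n];
  [exact: Qp|exact: Qn].
Qed.

Lemma ae_regular : {ae P, forall x, regular x}.
Proof.
have ac : {ae P, forall x, forall a, exists n, determined c a n x}.
  apply: ae_int => a; exact: ae_determined (recoding_inj cP) c_lt beta_level.
have ai : {ae P, forall x, forall b, exists n, determined id_code b n x}.
  apply: ae_int => b; exact: (@ae_determined _ H) id_inj id_lt beta_id.
apply: filterS2 ac ai => x xc xi; split=> k.
  by have [n] := xc k; exact: determined_c.
by have [n] := xi k; exact: determined_id.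
Qed.

(** This makes the set of points decided at stage 0 empty, where the decomposition into layers
    begins. *)
Hypothesis good0 : forall u, ~ good 0 u.
Hypothesis beta0 : 1 <= beta 0%N.
Hypothesis c_near : forall n k, (0 < n)%N -> (k < H n)%N ->
  (c n k <= k + D n /\ k <= c n k + D n)%N.

Let determined0 f a : determined f a 0%N = set0.
Proof.
apply/seteqP; split=> x //= [s _]; exact: good0 (s 0%N isT).
Qed.

Variables (phi : R -> R) (A : R).
Hypothesis A_ge0 : 0 <= A.
Hypothesis phi_ge0 : forall t, 0 <= t -> 0 <= phi t.
Hypothesis phi_bound : forall n k, (k <= 1 + 2 * D n.+1)%N ->
  phi k%:R <= A * e n.

Let integral_bound f M (j : X -> int) :
  (forall n k k', (k < H n)%N -> (k' < H n)%N -> f n k = f n k' -> k = k') ->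
  (forall n k, (0 < n)%N -> (k < H n)%N -> (f n k < M n)%N) ->
  (forall n, (0 < n)%N -> ((M n - H n).+1)%:R / (H n)%:R <= beta n) ->
  (forall n x, determined f 1 n x -> determined f 1 n.+1 x) ->
  (forall k, measurable (j @^-1` [set k])) ->
  (forall x, (forall n, ~ determined f 1 n x) -> j x = 0) ->
  (forall n x, determined f 1 n.+1 x -> (absz (j x) <= 1 + 2 * D n.+1)%N) ->
  (\int[P]_x (phi (absz (j x))%:R)%:E < +oo)%E.
Proof.
move=> fi fl bl mono mj j0 jD.
apply: (@integral_layers _ _ _ P (fun x => phi (absz (j x))%:R) (determined f 1)
  (A * e 0%N) (fun n => A * e n) (fun n => (2 + 2 * absz 1)%N%:R * beta n)).
- exact: (@measurable_int_comp _ _ _ j (fun k => phi (absz k)%:R)).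
- by move=> x; apply: phi_ge0.
- by move=> n; exact: measurable_determined.
- by move=> n x; exact: mono.
- exact: determined0.
- by rewrite mulr_ge0 // (le_trans _ (e_ge1 _)).
- by move=> n; rewrite mulr_ge0 // (le_trans _ (e_ge1 _)).
- by move=> x /j0 ->; apply: (@phi_bound 0%N 0%N).
- by move=> n x dx; apply: phi_bound; exact: jD.
- by move=> n; exact: determined_layer bl n beta0.
- set K : R := (2 + 2 * absz 1)%N%:R.
  have eb n : 0 <= beta n * e n by rewrite mulr_ge0 // (le_trans _ (e_ge1 _)).
  rewrite (eq_eseriesr (g := fun n => ((K * A)%:E * (beta n * e n)%:E)%E)).
    rewrite nneseriesZl; last by move=> n _; rewrite lee_fin.
    have s0 : (0 <= \sum_(0 <= n <oo) (beta n * e n)%:E)%E.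
      by apply: nneseries_ge0 => n _ _; rewrite lee_fin.
    by apply: lte_mul_pinfty => //; rewrite ?lee_fin ?mulr_ge0.
  by move=> n _; rewrite -EFinM; congr EFin; ring.
Qed.

Lemma jump_integral : (\int[P]_x (phi (absz (@jump r good c x))%:R)%:E < +oo)%E.
Proof.
apply: (@integral_bound c h _ (recoding_inj cP) c_lt beta_level).
- exact: determined_mono_c.
- exact: measurable_jump cP.
- move=> x nd; apply: jump_irregular => rx.
  by have [n dx] := shift2_determined_c (jumpP cP rx); apply: (nd n).
- move=> n x dx; have [rx|nx] := pselect (regular x);
  last by rewrite jump_irregular.
  have [k' [k'n s t ik E]] := determined_splice dx.
  have xy : shift2 1 (k'%:Z - (index_of n.+1 x)%:Z) x (splice n.+1 k' x).
    by exists n.+1; split; rewrite ?ik //; lia.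
  have [_ ->] := shift2_eql cP (jumpP cP rx) xy.
  (* The recoded levels differ by 1 and recoding moves each of the two indices by at most [D n.+1],
     whence [1 + 2 * D n.+1]. *)
  have := c_near (ltn0Sn n) k'n; have := c_near (ltn0Sn n) (index_of_lt n.+1 x).
  by move: (index_of _ _) (c _ _) (c _ k') E => k ck ck' E; lia.
Qed.

Lemma climb_integral : (\int[P]_x (phi (absz (@climb r good c x))%:R)%:E < +oo)%E.
Proof.
apply: (@integral_bound id_code H _ id_inj id_lt beta_id).
- exact: determined_mono_id.
- exact: measurable_climb cP.
- move=> x nd; apply: climb_irregular => rx.
  by have [n dx] := shift2_determined_id (climbP rx); apply: (nd n).
- move=> n x dx; have [rx|nx] := pselect (regular x);
  last by rewrite climb_irregular.
  have [k' [k'n s t ik E]] := determined_splice dx.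
  have xy : shift2 ((c n.+1 k')%:Z - (c n.+1 (index_of n.+1 x))%:Z) 1 x (splice
    n.+1 k' x).
    by exists n.+1; split; rewrite ?ik //; lia.
  have [_ ->] := shift2_eqr cP (climbP rx) xy.
  have := c_near (ltn0Sn n) k'n; have := c_near (ltn0Sn n) (index_of_lt n.+1 x).
  by move: E; rewrite /id_code; move: (index_of _ _) => k E; lia.
Qed.

End Integrals.

(** * Cutting and stacking *)

Definition copy_start (w : nat -> csparam) (n i : nat) : nat :=
  copy_offset (height w n) (spacer (w n)) i.

Lemma heightE (w : nat -> csparam) n : height w n.+1 = copy_start w n (cuts (w n)).
Proof. by []. Qed.

(** With [0 < n], the digit at position 0 never counts as a copy, so no point is settled at stage
    0. *)
Definition copy_digit (w : nat -> csparam) (pos : nat -> nat -> nat)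
    (n u : nat) : Prop :=
  (0 < n)%N /\ exists2 i, (i < cuts (w n))%N & u = pos n i.

Section CuttingStacking.
Variables (r : nat -> nat) (w : nat -> csparam) (pos c off : nat -> nat -> nat).
Local Notation X := (odometer_space r).
Local Notation H := (radix_prod r).
Local Notation h := (height w).
Local Notation q n := (cuts (w n)).
Local Notation o := (copy_start w).
Local Notation good := (copy_digit w pos).
Local Notation settled := (@settled r good).
Local Notation regular := (@regular r good c).
Local Notation shift2 := (@shift2 r good c).
Hypothesis cP : recoding r good c off.
Hypothesis offE : forall n i, (0 < n)%N -> (i < q n)%N -> off n (pos n i) = o n i.
Hypothesis pos_lt : forall n i, (0 < n)%N -> (i < q n)%N -> (pos n i < (r n).+2)%N.
Hypothesis c_lt : forall n k, (0 < n)%N -> (k < H n)%N -> (c n k < h n)%N.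

(* The levels of the (n + d)-th tower that form the base of the n-th one. *)
Fixpoint base_level (n d a : nat) : Prop :=
  if d is d'.+1 then
    exists i a', [/\ (i < q (n + d')%N)%N, base_level n d' a' &
                     a = (o (n + d')%N i + a')%N]
  else a = 0%N.

Let height_gt0 n : (0 < h n)%N.
Proof.
elim: n => // n IH; rewrite heightE /copy_start /copy_offset.
by have := cuts_ge2 (w n); nia.
Qed.

Let base_level_le n d a : base_level n d a -> (a + h n <= h (n + d)%N)%N.
Proof.
elim: d a => [|d IH] a /=; first by move=> ->; rewrite addn0.
move=> [i [a' [iq /IH a'h ->]]]; rewrite addnS heightE.
have := @copy_offset_le (h (n + d)%N) (spacer (w (n + d)%N)) i.+1 (q (n + d)%N) iq.
by rewrite copy_offsetS /copy_start; lia.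
Qed.

Let base_level_inj n d a a' t t' : base_level n d a -> base_level n d a' ->
  (t < h n)%N -> (t' < h n)%N -> (a + t = a' + t')%N -> a = a' /\ t = t'.
Proof.
elim: d a a' => [|d IH] a a' /=; first by move=> -> ->; split=> //; lia.
move=> [i [b [iq bb ->]]] [j [b' [jq bb' ->]]] th t'h E.
have bh := base_level_le bb; have b'h := base_level_le bb'.
have ij : i = j.
  have {}E : (o (n + d) i + (b + t) = o (n + d) j + (b' + t'))%N by lia.
  by apply: copy_offset_inj E; lia.
have {}E : (b + t = b' + t')%N by rewrite ij in E; lia.
by have [-> ->] := IH _ _ bb bb' th t'h E; rewrite ij.
Qed.

(** [base_level] recurses on the outermost copy; splitting off the innermost one instead relates the
    bases of the n-th and the next tower. *)
Let base_level_refine n d a : base_level n d.+1 a <->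
  exists i a', [/\ (i < q n)%N, base_level n.+1 d a' & a = (a' + o n i)%N].
Proof.
elim: d a => [|d IH] a.
  rewrite /= addn0; split=> -[i [a' [iq -> ->]]].
    by exists i, 0%N; rewrite addn0.
  by exists i, 0%N; rewrite addn0.
split.
  move=> [i [b [iq /IH[j [b' [jq bb' ->]]] ->]]].
  exists j, (o (n + d.+1) i + b')%N; split=> //; last by rewrite addnA.
  by exists i, b'; rewrite addSnnS.
move=> [j [b [jq [i [b' [iq bb' ->]]] ->]]].
exists i, (b' + o n j)%N; split=> //.
- by rewrite -addSnnS.
- by apply/IH; exists j, b'.
- by rewrite -addSnnS addnA.
Qed.

(* T^t (B_n), also when t >= h n. *)
Definition level (n t : nat) : set X := [set x | regular x /\ exists d,
  settled (n + d) x /\ exists2 a, base_level n d a &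
    c (n + d) (index_of (n + d) x) = (a + t)%N].

Let settled_step m x : settled m x -> exists2 i, (i < q m)%N &
  x m = pos m i :> nat /\
  c m.+1 (index_of m.+1 x) = (o m i + c m (index_of m x))%N.
Proof.
move=> s; have g := s m (leqnn m); have [m0 [i iq xi]] := g.
exists i => //; split=> //.
by rewrite index_ofS (recoding_step cP) ?index_of_lt // xi offE.
Qed.

Let level_large n t x : level n t x -> exists M, forall d, (M <= d)%N ->
  settled (n + d) x /\ exists2 a, base_level n d a &
    c (n + d) (index_of (n + d) x) = (a + t)%N.
Proof.
move=> [_ [M [s [a ba E]]]]; exists M => d /subnKC <-.
elim: (d - M)%N => [|k [s' [b bb Eb]]]; first by rewrite addn0; split=> //;
  exists a.
rewrite addnS; split.
  by apply: settledW s'; rewrite addnS.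
have [i iq [_ Ei]] := settled_step s'.
exists (o (n + (M + k)) i + b)%N; first by exists i, b.
by rewrite addnS Ei Eb addnA.
Qed.

Let level_disjoint n t t' x : (t < h n)%N -> (t' < h n)%N ->
  level n t x -> level n t' x -> t = t'.
Proof.
move=> th t'h /level_large[M xM] /level_large[M' xM'].
have [_ [a ba E]] := xM _ (leq_maxl M M').
have [_ [a' ba' E']] := xM' _ (leq_maxr M M').
rewrite E in E'.
by have [] := base_level_inj ba ba' th t'h E'.
Qed.

Let measurable_level n t : measurable (level n t).
Proof.
rewrite (_ : level n t = [set x | regular x] `&` \bigcup_d
  ([set x | settled (n + d) x] `&` [set x : X | [set k | exists2 a, base_level
    n d a &
    c (n + d) k = (a + t)%N] (index_of (n + d) x)])).
  apply: measurableI; first exact: measurable_regular.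
  apply: bigcupT_measurable => d; apply: measurableI;
    first exact: measurable_settled.
  exact: measurable_index.
apply/seteqP; split=> x /=; first by move=> [rx [d sx]]; split=> //; exists d.
by move=> [rx [d _ sx]]; split=> //; exists d.
Qed.

Let refine_level n : \bigcup_(i in `I_(q n)) level n.+1 (o n i) = level n 0.
Proof.
apply/seteqP; split=> [x [i /= iq [rx [d [s [a ba E]]]]]|x lx].
  split=> //; exists d.+1; rewrite -addSnnS; split=> //.
  by exists (a + o n i)%N; [apply/base_level_refine; exists i, a | rewrite E addn0].
have [M xM] := level_large lx.
have [s [a /base_level_refine[i [a' [iq ba' ->]]] E]] := xM M.+1 (leqnSn M).
exists i => //; split; first by have [] := lx.
by exists M; rewrite addSnnS; split=> //; exists a' => //; rewrite E addn0.
Qed.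

(* An index at a later stage whose level is that of k in a copy of the n-th
   tower has n-th residue k and digits in copies from n on. *)
Let copied_code n d a k : (0 < n)%N -> base_level n d a -> (k < H n)%N ->
  exists2 k', (k' < H (n + d))%N & c (n + d) k' = (a + c n k)%N /\
    forall x : X, index_of (n + d) x = k' -> settled (n + d) x ->
      settled n x /\ index_of n x = k.
Proof.
move=> n0; elim: d a => [|d IH] a /=.
  move=> -> kn; exists k; rewrite addn0 //.
move=> [i [a' [iq /IH IH' ->]]] /IH' [k' k'n [E sx]].
have nd0 : (0 < n + d)%N by rewrite addn_gt0 n0.
have g : good (n + d) (pos (n + d) i) by split=> //; exists i.
exists (pos (n + d) i * H (n + d) + k')%N.
  have := pos_lt nd0 iq; rewrite addnS radix_prodS => pp.
  by move: pp k'n; move: (pos _ _) (H _) (_.+2); nia.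
rewrite addnS; split.
  by rewrite (recoding_step cP) // offE // E addnA.
move=> x xk s; have xi : index_of (n + d) x = k'.
  by rewrite -index_of_mod xk modnMDl modn_small.
apply: sx => // m; rewrite leq_eqVlt => /predU1P[<-|]; last exact: s.
by rewrite -index_of_div xk divnMDl // divn_small // addn0.
Qed.

(** A level of the T-tower that carries a V-level at stage [n] receives no further points later.
    This is how cylinders are recovered from tower levels. *)
Let level_code n k : (0 < n)%N -> (k < H n)%N ->
  level n (c n k) = [set x | [/\ regular x, settled n x & index_of n x = k]].
Proof.
move=> n0 kn; apply/seteqP; split=> [x [rx [d [s [a ba E]]]]|x [rx s xk]].
  have [k' k'n [E' sx]] := copied_code n0 ba kn.
  have xk : index_of (n + d) x = k'.
    by apply: (@recoding_inj _ _ _ _ cP (n + d)%N); rewrite ?index_of_lt // E E'.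
  by have [sn xn] := sx _ xk s.
by split=> //; exists 0%N; rewrite addn0; split=> //; exists 0%N => //; rewrite xk.
Qed.

Section Towers.
Variables (R : realType) (P : probability X R) (unif : product_of_uniforms P).
Variable T : aut P.
Hypotheses (TE : forall x, T x = levelshift good c 1 x)
  (TVE : forall x, mp_inv T x = levelshift good c (- 1) x).
Hypothesis ae_reg : {ae P, forall x, regular x}.

(** At a late enough stage the shift stays inside the tower and just translates levels, which is why
    [t + k] may exceed the height of the n-th tower. *)
Let image_level n t k : iter k T @` level n t = level n (t + k).
Proof.
apply/seteqP; split=> [_ [x lx <-]|y ly].
  have rx : regular x by have [] := lx.
  have [b xy] : exists b, shift2 k b x (iter k T x) := zpow_levelshift cP TE
    TVE k rx.
  move: (iter k T x) xy => y xy.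
  split; first exact: regular_shift2 cP _ _ _ _ xy rx.
  have [M xM] := level_large lx; have [N xN] := shift2_large cP xy.
  exists (maxn M N); have [s [a ba E]] := xM _ (leq_maxl M N).
  have nN : (N <= n + maxn M N)%N by rewrite (leq_trans (leq_maxr M N)) // leq_addl.
  have [_ t' ca _] := xN _ nN.
  split; first exact: settled_tail t' s.
  by exists a => //; move: ca; rewrite E; lia.
have ry : regular y by have [] := ly.
have [b xy] := zpow_levelshift cP TE TVE (- k%:Z) ry.
have kK : iter k T (zpow T (- k%:Z) y) = y.
  by have := zpowK T (- k%:Z) y; rewrite opprK.
exists (zpow T (- k%:Z) y) => //; move: (zpow T (- k%:Z) y) xy => x xy.
split; first exact: regular_shift2 cP _ _ _ _ xy ry.
have [M xM] := level_large ly; have [N xN] := shift2_large cP xy.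
exists (maxn M N); have [s [a ba E]] := xM _ (leq_maxl M N).
have nN : (N <= n + maxn M N)%N by rewrite (leq_trans (leq_maxr M N)) // leq_addl.
have [_ t' ca _] := xN _ nN.
split; first exact: settled_tail t' s.
by exists a => //; move: ca; rewrite E; lia.
Qed.

Let image1 n t : T @` level n t = level n t.+1.
Proof. by rewrite -addn1 -image_level. Qed.

Let o_ge n i : (spacer (w n) i <= o n i)%N.
Proof.
rewrite /copy_start; case: i => [|i]; first by rewrite copy_offset0.
by rewrite copy_offsetS leq_addl.
Qed.

Let oS n i : o n i.+1 = (o n i + h n + spacer (w n) i.+1)%N.
Proof. exact: copy_offsetS. Qed.

Let o_lt n i : (i < q n)%N -> (o n i < h n.+1)%N.
Proof.
move=> iq; rewrite heightE.
have := @copy_offset_le (h n) (spacer (w n)) i.+1 (q n) iq.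
by have := height_gt0 n; rewrite copy_offsetS /copy_start; lia.
Qed.

(** The i-th group of spacers lies immediately below the i-th copy, or at the very top when [i] is
    the number of cuts; [j] counts from 1. *)
Let Sig n i j := level n.+1 (o n i - spacer (w n) i + j.-1)%N.

Let tower_sets := [set L : set X | exists n k, (k < h n)%N /\ L = iter k T @`
  level n 0].

Let level_tower_set n t : (t < h n)%N -> <<s tower_sets >> (level n t).
Proof.
by move=> th; apply: sub_sigma_algebra; exists n, t; split; rewrite ?image_level.
Qed.

Let generating A : measurable A -> exists A', <<s tower_sets >> A' /\
  forall x, regular x -> A x <-> A' x.
Proof.
move: A; apply: smallest_sub.
  split=> /= [|A [A' [sA' AA']]|F FF'].
  - by exists set0; split=> //;
    exact: (@measurable0 _ (g_sigma_algebraType tower_sets)).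
  - exists (~` A'); split; first exact: (@measurableC _ (g_sigma_algebraType
    tower_sets)).
    move=> x rx; have [h1 h2] := AA' x rx.
    by split=> [[_ nA] /h2|nA'] //; split=> // /h1.
  - have [F' FF''] := choice FF'; exists (\bigcup_n F' n); split.
      apply: (@bigcupT_measurable _ (g_sigma_algebraType tower_sets)) => n.
      by have [] := FF'' n.
    move=> x rx; split=> -[n _ Fx]; exists n => //;
      have [_ /(_ x rx)[h1 h2]] := FF'' n.
      exact: h1.
    exact: h2.
move=> _ [n [a ->]].
(* Up to irregular points, the cylinder is the union, over the stages [m > n], of the tower levels
   carrying a V-level whose digit at position [n] is [a]. A point is caught as soon as it is
   settled. *)
exists (\bigcup_(m in [set m | (n < m)%N])
  \bigcup_(k in [set k | (k < H m)%N /\ (k %% H n.+1 %/ H n)%N = a]) level m (c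
    m k)).
split.
  apply: (@bigcup_measurable _ (g_sigma_algebraType tower_sets)) => m /= nm.
  apply: (@bigcup_measurable _ (g_sigma_algebraType tower_sets)) => k [/= km _].
  by apply: level_tower_set; apply: c_lt => //; apply: leq_ltn_trans nm.
move=> x rx; split=> /=.
  move=> xa; have [M s] := regular_settled rx.
  have nm : (n < maxn M n.+1)%N by rewrite leq_maxr.
  exists (maxn M n.+1) => //; exists (index_of (maxn M n.+1) x) => /=.
    by rewrite index_of_lt index_of_dec // index_of_div xa.
  rewrite level_code ?index_of_lt //; last exact: leq_ltn_trans nm.
  by split=> //; apply: settledW s; exact: leq_maxl.
move=> [m /= nm [k [/= km ka]]]; rewrite level_code //;
  last exact: leq_ltn_trans nm.
move=> [_ _ xk]; apply: val_inj; rewrite /= -ka -xk.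
by rewrite index_of_dec // index_of_div.
Qed.

Lemma levelshift_construction : cutting_stacking T w
  (fun n => level n 0) (fun n i => level n.+1 (o n i)) Sig.
Proof.
split=> [n|n i _|n i j _ _|n|n|n|n i iq s0|n i iq s0|n i j iq|n i iq s0|n s0|n
  s0|A mA].
- exact: measurable_level.
- exact: measurable_level.
- exact: measurable_level.
- apply/trivIsetP => i j /= ih jh ij;
  rewrite !image_level !add0n -subset0 => x [xi xj].
  by move: ij; rewrite (level_disjoint ih jh xi xj) eqxx.
- exact: refine_level.
- apply/trivIsetP => i j /= iq jq ij; rewrite -subset0 => x [xi xj].
  have E := level_disjoint (o_lt iq) (o_lt jq) xi xj.
  have {}E : (o n i + 0 = o n j + 0)%N by rewrite !addn0.
  by move: ij; rewrite (copy_offset_inj (height_gt0 n) (height_gt0 n) E) eqxx.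
- by rewrite image_level /Sig oS addnK addn0.
- by rewrite image_level oS s0 addn0.
- move=> /andP[j1 js]; rewrite image1 /Sig.
  by congr level; lia.
- rewrite image1; congr level.
  by have := o_ge n i; lia.
- by rewrite /Sig /copy_start copy_offset0 subnn.
- by rewrite /copy_start copy_offset0 s0.
- have [A' [sA' AA']] := generating mA; exists A'; split=> //.
  move: ae_reg => [N [mN N0 NR]]; exists N; split=> //.
  move=> x AA'x; apply: NR => rx /=; have [h1 h2] := AA' x rx.
  by case: AA'x => -[Ax nA]; apply: nA; [exact: h1 | exact: h2].
Qed.

End Towers.

End CuttingStacking.

(** * Choice of the parameters *)

(* The lower bound imposed on the number of cuts of stage m - 1 in a tower of
   height g; threshold_le below is what the first summand is made for. *)
Definition cut_threshold (L m g : nat) : nat :=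
  (8 ^ m * ((2 * m + 1 + L) * g) ^ 3 * (4 * m + 11) + (m * g).+1)%N.

Section TowerSizes.
Local Open Scope nat_scope.
Variables (w : nat -> csparam) (L : nat).
Local Notation h := (height w).
Local Notation q n := (cuts (w n)).
Local Notation o := (copy_start w).

(* The next V-tower is the highest one below h n.+1 whose number of units is a
   multiple of n.+1.  At stage 0 the two levels are enough, and no copy is
   used. *)
Definition unit_count (n g : nat) : nat :=
  if n is 0 then 2 else (h n.+1).-1 %/ (g * n.+1) * n.+1.

Fixpoint tower_size (n : nat) : nat :=
  if n is m.+1 then unit_count m (tower_size m) * tower_size m else 1.

Local Notation H := tower_size.
Definition radix (n : nat) : nat := (unit_count n (H n)).-2.
Local Notation p n := (radix n).+2.

Definition place (n : nat) : nat -> nat :=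
  copy_unit (h n) (H n) (q n) (p n) (spacer (w n)).

Fixpoint recode (n : nat) : nat -> nat :=
  match n with
  | 0 => fun=> 0
  | 1 => id
  | m.+1 => refine (h m) (H m) (q m) (p m) (spacer (w m)) (recode m)
  end.

(** By injectivity of [place n] the copy can be read back from its digit; a digit that is no copy
    gets the default [o n 0]. *)
Definition place_offset (n u : nat) : nat :=
  o n (xget 0 [set i | i < q n /\ place n i = u]).

(* Both recodings 0 and 1 are exact, hence the value 0. *)
Definition code_error (n : nat) : nat :=
  if n is m.+1 then if m is 0 then 0 else h m + (H m + n + 2) * H m else 0.

Hypothesis w0 : 3 <= q 0.
Hypothesis w_cuts : forall n, 0 < n -> cut_threshold L n.+1 (h n) <= q n.
Hypothesis w_spacers : forall n, 0 < n -> spacer_sum (w n) <= L * q n * h n.-1.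

(** From [H n < h n] follows [q n * h n >= q n * H n + q n], and the second summand of
    [cut_threshold] makes [q n] exceed [n.+1 * H n], which bounds the rounding loss. Hence at least
    [q n] units fit. *)
Let step n : 0 < n -> 0 < H n < h n ->
  [/\ q n <= unit_count n (H n), unit_count n (H n) * H n < h n.+1 &
      h n.+1 <= (unit_count n (H n) + n.+1) * H n].
Proof.
case: n => // n _; set m := n.+1; set g := H m => /andP[g0 gh].
have hE : h m.+1 = q m * h m + spacer_sum (w m) by [].
have qg : m.+1 * g < q m.
  apply: leq_trans (w_cuts (ltn0Sn n)); rewrite /cut_threshold -/m.
  apply: (@leq_trans (m.+1 * h m).+1); last exact: leq_addl.
  by rewrite ltnS leq_mul2l ltnW.
have h0 : 0 < h m.+1 by rewrite hE; nia.
rewrite /unit_count -/m.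
set u := (h m.+1).-1 %/ (g * m.+1).
have E := divn_eq (h m.+1).-1 (g * m.+1).
have lt : (h m.+1).-1 %% (g * m.+1) < g * m.+1 by rewrite ltn_mod muln_gt0 g0.
rewrite -/u in E.
have lo : u * m.+1 * g < h m.+1 by move: E h0; lia.
have hi : h m.+1 <= (u * m.+1 + m.+1) * g by move: E h0 lt; lia.
split=> //; rewrite leqNgt; apply/negP => pq.
have : (u * m.+1 + 1) * g <= q m * g by rewrite leq_mul2r addn1 pq orbT.
have : q m * g + q m <= h m.+1.
  by rewrite hE; apply: leq_trans (leq_addr _ _); rewrite -mulnSr leq_mul2l gh orbT.
by move: hi qg; rewrite !mulnDl; lia.
Qed.

Let size_bounds n : 0 < H n.+1 < h n.+1.
Proof.
elim: n => [|n /[dup] /andP[H0 _] IH].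
  (* Base case: [H 1 = 2], while [h 1 >= q 0 >= 3]. *)
  by rewrite /=; lia.
have [qp lt _] := step (ltn0Sn n) IH; have := cuts_ge2 (w n.+1).
by rewrite -[H n.+2]/(unit_count n.+1 (H n.+1) * H n.+1) muln_gt0 H0 lt; lia.
Qed.

Lemma tower_size_gt0 n : 0 < H n.
Proof. by case: n => // n; case/andP: (size_bounds n). Qed.

Lemma tower_size_lt n : 0 < n -> H n < h n.
Proof. by case: n => // n _; case/andP: (size_bounds n). Qed.

Let stepP n : 0 < n ->
  [/\ q n <= unit_count n (H n), unit_count n (H n) * H n < h n.+1 &
      h n.+1 <= (unit_count n (H n) + n.+1) * H n].
Proof. by move=> n0; apply: step => //; rewrite tower_size_gt0 tower_size_lt. Qed.

Lemma radixE n : p n = unit_count n (H n).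
Proof.
rewrite /radix; case: n => // n; have [+ _ _] := stepP (ltn0Sn n).
by have := cuts_ge2 (w n.+1); lia.
Qed.

Lemma tower_sizeE n : radix_prod radix n = H n.
Proof.
elim: n => [|n IH]; first by rewrite radix_prod0.
by rewrite radix_prodS IH radixE.
Qed.

Lemma cuts_le_radix n : 0 < n -> q n <= p n.
Proof. by rewrite radixE => /stepP[]. Qed.

Lemma radix_fill_lt n : 0 < n -> p n * H n < h n.+1.
Proof. by rewrite radixE => /stepP[]. Qed.

Lemma radix_fill_ge n : 0 < n -> h n.+1 <= (p n + n.+1) * H n.
Proof. by rewrite radixE => /stepP[]. Qed.

Lemma radix_dvd n : 0 < n -> n.+1 %| p n.
Proof. by rewrite radixE; case: n => // n _; exact: dvdn_mull. Qed.

(** A prime [l] divides the radix at each position [n] such that [l] divides [n.+1], and [M] such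
    positions lie below [l * M]; all are positive because [l > 1]. *)
Lemma radix_universal : universal_radices radix.
Proof.
move=> l M pl; exists (l * M); elim: M => // M IH.
have l1 := prime_gt1 pl.
have lM : l * M <= l * M.+1 by rewrite leq_mul2l leqnSn orbT.
rewrite -(big_mkord xpredT (fun n => logn l (p n))) (big_cat_nat (leq0n (l *
  M)) lM) /= big_mkord.
rewrite -[X in X <= _]addn1 leq_add //.
have n0 : 0 < (l * M.+1).-1 by rewrite mulnS; lia.
have nS : (l * M.+1).-1.+1 = l * M.+1 by rewrite mulnS; lia.
rewrite -nS big_nat_recr /=; last by rewrite mulnS; lia.
apply: leq_trans (leq_addl _ _); rewrite -pfactor_dvdn // expn1.
apply: dvdn_trans (radix_dvd n0); rewrite nS; exact: dvdn_mulr.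
Qed.

Let codeS n : 0 < n ->
  recode n.+1 = refine (h n) (H n) (q n) (p n) (spacer (w n)) (recode n).
Proof. by case: n. Qed.

Let code_inv n :
  (forall k, k < H n -> 0 < n -> recode n k < h n) /\
  (forall k k', k < H n -> k' < H n -> recode n k = recode n k' -> k = k').
Proof.
elim: n => [|n [clt cinj]]; first by split=> // -[|k] // [|k'].
case: (posnP n) => [->|n0].
  by split=> // k /= k2 _; lia.
rewrite (codeS n0).
have HS : H n.+1 = p n * H n by rewrite /= radixE.
have fillP : filling (h n) (H n) (q n) (p n) n.+1 (spacer (w n)) (recode n).
  split=> //; first exact: tower_size_gt0; first exact: tower_size_lt.
  - exact: cuts_le_radix.
  - by move=> k kH; exact: clt.
  - exact: radix_fill_lt.
  - exact: radix_fill_ge.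
split=> [k|k k']; rewrite HS; last exact: (refine_inj fillP).
by move=> kp _; exact: (refine_lt fillP kp).
Qed.

Lemma code_lt n k : 0 < n -> k < H n -> recode n k < h n.
Proof. by move=> n0 kH; have [clt _] := code_inv n; exact: clt. Qed.

Lemma code_inj n k k' : k < H n -> k' < H n -> recode n k = recode n k' -> k = k'.
Proof. by have [_] := code_inv n; apply. Qed.

Let code_filling n : 0 < n ->
  filling (h n) (H n) (q n) (p n) n.+1 (spacer (w n)) (recode n).
Proof.
move=> n0; split; [exact: tower_size_gt0 | exact: tower_size_lt |
  exact: cuts_le_radix | by move=> k; exact: code_lt | exact: code_inj |
  exact: radix_fill_lt | exact: radix_fill_ge].
Qed.

Lemma code_near n k : 0 < n -> k < H n ->
  recode n k <= k + code_error n /\ k <= recode n k + code_error n.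
Proof.
case: n => // n _; case: (posnP n) => [->|n0 kH]; first by rewrite addn0.
have HS : H n.+1 = p n * H n by rewrite /= radixE.
rewrite (codeS n0) (_ : code_error _ = h n + (H n + n.+1 + 2) * H n);
  last by case: (n) n0.
rewrite HS in kH.
exact: (refine_near (code_filling n0) kH).
Qed.

Lemma place_inj n i j : 0 < n -> place n i = place n j -> i = j.
Proof. by move=> /code_filling fP; exact: (copy_unit_inj fP). Qed.

Lemma place_lt n i : 0 < n -> i < q n -> place n i < p n.
Proof. by move=> /code_filling fP; exact: (copy_unit_lt fP). Qed.

Lemma place_offsetE n i : 0 < n -> i < q n -> place_offset n (place n i) = o n i.
Proof.
move=> n0 iq; have : exists j, j < q n /\ place n j = place n i by exists i.
by rewrite /place_offset => /(xgetPex 0)[_ /(place_inj n0) ->].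
Qed.

Lemma code_recoding : recoding radix (copy_digit w place) recode place_offset.
Proof.
split=> [n k k'|n _ k [n0 [i iq ->]]]; rewrite tower_sizeE; first exact: code_inj.
move=> kH; rewrite place_offsetE // (codeS n0).
exact: (refine_copy (code_filling n0) iq kH).
Qed.

Lemma tower_loss n : 1 < n -> h n <= H n + n * H n.-1.
Proof.
case: n => // n; rewrite ltnS => n0; rewrite /= -radixE -mulnDl.
exact: radix_fill_ge.
Qed.

Lemma tower_size_le_height n : H n <= h n.
Proof. by case: n => // n; apply: ltnW; exact: tower_size_lt. Qed.

(** Additional units are filled with the [q n * (h n - H n)] levels missed in the copies and with
    the spacers, whose number is bounded through the third condition on flexible classes. *)
Lemma extra_units_le n : 0 < n -> (p n - q n) * H n <= p n * (h n - H n + L * h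
  n.-1).
Proof.
move=> n0; have qp := cuts_le_radix n0.
have lt := radix_fill_lt n0; have sp := w_spacers n0.
have Hh := ltnW (tower_size_lt n0).
have hE : h n.+1 = q n * h n + spacer_sum (w n) by [].
apply: (@leq_trans (q n * (h n - H n + L * h n.-1)));
  last by rewrite leq_mul2r qp orbT.
rewrite mulnBl leq_subLR mulnDr addnA -mulnDr subnKC //.
apply: leq_trans (ltnW lt) _; rewrite hE leq_add2l; apply: leq_trans sp _.
by rewrite mulnA [q n * L]mulnC.
Qed.

Lemma code_error_le n : 1 < n ->
  1 + 2 * code_error n.+1 <= (4 * n + 11) * (H n) ^ 2.
Proof.
move=> n1; have n0 := ltnW n1; have loss := tower_loss n1.
have H0 := tower_size_gt0 n.
have HH : H n.-1 <= H n.
  case: (n) n1 => // k k0; rewrite -[H k.+1]/(unit_count k (H k) * H k) -radixE.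
  by rewrite leq_pmull.
rewrite (_ : code_error _ = h n + (H n + n.+1 + 2) * H n); last by case: (n) n0.
have : h n <= n.+1 * H n.
  by apply: leq_trans loss _; rewrite mulSn leq_add2l leq_mul2l HH orbT.
by move: (h n) (H n) H0 => a b b0 ab; rewrite expnS expn1; nia.
Qed.

(** Two factors [H n] pay for [code_error_le]; the third one is at least [q n.-1] and pays for the
    rest of the threshold. *)
Lemma threshold_le n : 1 < n ->
  (1 + 2 * code_error n.+1) * (8 ^ n * ((2 * n + 1 + L) * h n.-1) ^ 3) <= (H n) ^ 3.
Proof.
move=> n1; have := w_cuts (n := n.-1); rewrite prednK ?(ltnW n1) // => /(_ _) thr.
have {}thr : cut_threshold L n (h n.-1) <= q n.-1 by apply: thr; lia.
have qH : q n.-1 <= H n.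
  case: (n) n1 {thr} => // k k0; rewrite /=.
  rewrite -radixE; apply: leq_trans (cuts_le_radix _) (leq_pmulr _
    (tower_size_gt0 _)) => //.
have {thr} := leq_trans thr qH; rewrite /cut_threshold.
set B := _ ^ 3; set K := 8 ^ n => thr.
have := code_error_le n1; set E := 1 + _ => Ele.
apply: (@leq_trans ((4 * n + 11) * H n ^ 2 * (K * B)));
  first by rewrite leq_mul2r Ele orbT.
rewrite mulnAC [H n ^ 3]expnSr [H n ^ 2 * _]mulnC leq_mul2r; apply/orP; right.
by apply: leq_trans thr; rewrite mulnC leq_addr.
Qed.

End TowerSizes.

(** * Convergence of the series and realization of a parameter sequence *)

Section Realization.
Variables (R : realType) (w : nat -> csparam) (L : nat).
Local Notation h := (height w).
Local Notation q n := (cuts (w n)).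
Local Notation H := (tower_size w).
Local Notation r := (radix w).
Local Notation X := (odometer_space r).
Local Notation good := (copy_digit w (place w)).
Hypothesis w0 : (3 <= q 0%N)%N.
Hypothesis w_cuts : forall n, (0 < n)%N -> (cut_threshold L n.+1 (h n) <= q n)%N.
Hypothesis w_spacers : forall n, (0 < n)%N ->
  (spacer_sum (w n) <= L * q n * h n.-1)%N.

(* Up to a constant, a bound for the measure of the points whose successor is
   decided at stage n.+1 but not at stage n. *)
Definition loss (n : nat) : R :=
  if n is 0%N then 1
  else (2 * (h n - H n) + 1 + L * h n.-1)%N%:R / (H n)%:R.

(** Up to a constant, a bound for [phi] at the cocycle values decided at stage [n.+1]. *)
Definition cost (n : nat) : R :=
  (1 + 2 * code_error w n.+1)%N%:R `^ (3%:R^-1).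

Let H_gt0 n : (0 < H n)%N. Proof. exact: (tower_size_gt0 w0 w_cuts). Qed.

Let h_gt0 n : (0 < h n)%N.
Proof. by apply: leq_trans (H_gt0 n) _;
  exact: (tower_size_le_height w0 w_cuts n). Qed.

Lemma cost_ge1 n : 1 <= cost n.
Proof.
apply: (@le_trans _ _ (1 `^ (3%:R^-1))); first by rewrite powR1.
by rewrite ge0_ler_powR ?nnegrE ?invr_ge0 // ler1n.
Qed.

Lemma loss_level n : (0 < n)%N ->
  ((h n - radix_prod r n).+1)%:R / (radix_prod r n)%:R <= loss n.
Proof.
case: n => // n _; rewrite (tower_sizeE w0 w_cuts) /loss ler_pM2r ?invr_gt0
  ?ltr0n //.
by rewrite ler_nat; lia.
Qed.

Lemma loss_good (P : probability X R) : product_of_uniforms P ->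
  forall n, (P [set x : X | ~ good n (x n)] <= (loss n)%:E)%E.
Proof.
move=> unif [|n].
  apply: probability_le1.
  rewrite (_ : [set _ | _] = setT) //; apply/seteqP; split=> // x _ [].
  by [].
have n0 := ltn0Sn n.
apply: (le_trans (measure_digit unif (g := good n.+1) (q := q n.+1) (pos :=
  place w n.+1) _ _)).
- by move=> i iq; split; [exact: (place_lt w0 w_cuts n0 iq) | split=> //; exists i].
- by move=> i j _ _; exact: (place_inj w0 w_cuts n0).
rewrite lee_fin /loss ler_pdivrMr ?ltr0n // mulrAC ler_pdivlMr ?ltr0n //.
rewrite -!natrM ler_nat; apply: leq_trans (extra_units_le w0 w_cuts w_spacers n0) _.
by rewrite mulnC leq_mul2r; apply/orP; right; lia.
Qed.

Let cube_root_le (E K N : nat) : (0 < K)%N -> (E * K ^ 3 <= N ^ 3)%N ->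
  E%:R `^ (3%:R^-1) <= N%:R / K%:R :> R.
Proof.
move=> K0 EN; have y0 : 0 <= N%:R / K%:R :> R by rewrite divr_ge0.
have -> : N%:R / K%:R = ((N%:R / K%:R) ^+ 3) `^ (3%:R^-1) :> R.
  by rewrite -powR_mulrn // -powRrM mulfV ?pnatr_eq0 // powRr1.
rewrite ge0_ler_powR ?nnegrE ?invr_ge0 ?exprn_ge0 //.
by rewrite expr_div_n ler_pdivlMr ?exprn_gt0 ?ltr0n // -!natrX -natrM ler_nat.
Qed.

Lemma loss_ge0 n : 0 <= loss n.
Proof. by rewrite /loss; case: n => // n; rewrite divr_ge0. Qed.

(** [tower_loss] bounds the loss by [B / H n], and the threshold bounds the cost by
    [H n / (2 ^ n * B)]: its factor [8 ^ n] is there for the cube root to leave [2 ^ n]. *)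
Lemma loss_cost n : (1 < n)%N -> loss n * cost n <= (2 ^+ n)^-1.
Proof.
move=> n1; have thr := threshold_le w0 w_cuts n1.
set B := ((2 * n + 1 + L) * h n.-1)%N in thr.
have B0 : (0 < B)%N by rewrite muln_gt0 h_gt0 andbT; lia.
have {}thr : ((1 + 2 * code_error w n.+1) * (2 ^ n * B) ^ 3 <= H n ^ 3)%N.
  by apply: leq_trans thr; rewrite expnMn -expnM mulnC [(n * 3)%N]mulnC expnM mulnC.
have cl : cost n <= (H n)%:R / (2 ^ n * B)%N%:R.
  by apply: cube_root_le thr; rewrite muln_gt0 expn_gt0.
have ll : loss n <= B%:R / (H n)%:R.
  case: (n) n1 @B {thr cl B0} => // m m1 B;
    rewrite /loss ler_pM2r ?invr_gt0 ?ltr0n //.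
  rewrite ler_nat /B /=; have := tower_loss w0 w_cuts m1; rewrite /=.
  have := tower_size_le_height w0 w_cuts m; have := h_gt0 m.
  by move: (H m.+1) (h m.+1) (H m) (h m) => *; nia.
have c0 : 0 <= cost n by rewrite powR_ge0.
apply: le_trans (ler_pM (loss_ge0 n) c0 ll cl) _.
have H0 : (H n)%:R != 0 :> R by rewrite pnatr_eq0 -lt0n.
have B0' : B%:R != 0 :> R by rewrite pnatr_eq0 -lt0n.
by rewrite natrM natrX invfM mulrA mulfVK // mulrCA mulfV ?mulr1 // lexx.
Qed.

Lemma loss_cost_sum : (\sum_(0 <= n <oo) (loss n * cost n)%:E < +oo)%E.
Proof.
(* The two initial terms, to which [loss_cost] does not apply, go into the constant; the summand 1
   serves all the others. *)
pose M := loss 0%N * cost 0%N + loss 1%N * cost 1%N + 1.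
have t0 n : 0 <= loss n * cost n by rewrite mulr_ge0 ?loss_ge0 ?powR_ge0.
have M0 : 0 <= M by rewrite !addr_ge0.
apply: (@le_lt_trans _ _ (\sum_(0 <= n <oo) (4 * M / (2 ^ n.+1)%N%:R)%:E)%E).
  apply: lee_nneseries => n _; rewrite lee_fin // ler_pdivlMr ?ltr0n ?expn_gt0 //.
  have t0' := t0 0%N; have t1' := t0 1%N.
  case: n => [|[|n]].
  - by rewrite expn1 /M; nra.
  - by rewrite /M (_ : (2 ^ 2)%N = 4%N) //; nra.
  - have := loss_cost (isT : (1 < n.+2)%N).
    rewrite -(@ler_pM2r _ (2 ^ n.+3)%N%:R) ?ltr0n ?expn_gt0 // => /le_trans; apply.
    rewrite expnS natrM natrX mulrCA mulVf ?expf_neq0 // /M; nra.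
apply: le_lt_trans (ltry (4 * M)).
by apply: epsilon_trick0; rewrite mulr_ge0.
Qed.

(** The proportion of spacers is at most [loss n], and [cost n >= 1]; so condition (F) follows from
    the convergence needed for integrability. *)
Lemma small_spacers : condF R w.
Proof.
apply: le_lt_trans loss_cost_sum; apply: lee_nneseries => n _;
  rewrite lee_fin ?divr_ge0 //.
apply: (@le_trans _ _ (loss n)); last first.
  by rewrite -{1}[loss n]mulr1 ler_wpM2l ?loss_ge0 // cost_ge1.
rewrite ler_pdivrMr ?ltr0n //.
case: n => [|n]; first by rewrite /loss mul1r ler_nat /= leq_addl.
rewrite /loss mulrAC ler_pdivlMr ?ltr0n // -!natrM ler_nat.
have sp := w_spacers (ltn0Sn n).
have Hh := tower_size_le_height w0 w_cuts n.+1.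
have hh : (q n.+1 * h n.+1 <= h n.+2)%N by rewrite leq_addr.
apply: (@leq_trans (L * q n.+1 * h n * h n.+1)%N); first by rewrite leq_mul.
rewrite (_ : (L * q n.+1 * h n * h n.+1 = L * h n * (q n.+1 * h n.+1))%N);
  last by lia.
by rewrite leq_mul //=; lia.
Qed.

Lemma realization (phi : R -> R) :
  (forall t, 0 <= t -> 0 <= phi t) ->
  phi =o_ (pinfty_nbhs R) (fun t : R => t `^ (3%:R^-1)) ->
  exists T : system R, has_construction T w /\
    exists U : system R, universal_odometer U /\
      integrably_orbit_equivalent phi T U.
Proof.
move=> phi_ge0 /little_o_cube_root[A A0 phiA].
have [P unif] := uniform_exists R r.
have cP := code_recoding w0 w_cuts.
have c_lt n k : (0 < n)%N -> (k < radix_prod r n)%N -> (recode w n k < h n)%N.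
  by rewrite (tower_sizeE w0 w_cuts); exact: (code_lt w0 w_cuts).
have good0 u : ~ good 0 u by case.
have reg := ae_regular unif cP (loss_good unif) loss_cost_sum cost_ge1 c_lt
  loss_level.
have [T [TE TVE]] := levelshift_aut cP unif.
pose st := odometer_standard R r; pose atl := uniform_atomless unif.
exists (System st atl T); split.
  exists (fun n => level w (place w) (recode w) n 0).
  exists (fun n i => level w (place w) (recode w) n.+1 (copy_start w n i)).
  eexists; apply: (levelshift_construction cP _ _ c_lt TE TVE reg).
  - by move=> n i n0; exact: (place_offsetE w0 w_cuts n0).
  - by move=> n i n0; exact: (place_lt w0 w_cuts n0).
exists (System st atl (odometer unif)); split.
  exists r, P, (odometer unif); split=> //;
    first exact: (radix_universal w0 w_cuts).
  by exists (id_iso P); exact: aeW.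
have c_near n k : (0 < n)%N -> (k < radix_prod r n)%N ->
    (recode w n k <= k + code_error w n /\ k <= recode w n k + code_error w n)%N.
  by rewrite (tower_sizeE w0 w_cuts); exact: (code_near w0 w_cuts).
have phi_bd n k : (k <= 1 + 2 * code_error w n.+1)%N -> phi k%:R <= A * cost n.
  by move=> kE; exact: phiA.
split.
- exact: (levelshift_aperiodic cP TE TVE reg).
- exact: odometer_aperiodic.
exists (id_iso P); split; first exact: (levelshift_same_orbits cP unif TE TVE reg).
exists (jump good (recode w)), (climb good (recode w)); split.
- exact: (levelshift_cocycles cP unif TE TVE reg).
- exact: (jump_integral unif cP (loss_good unif) loss_cost_sum cost_ge1
    c_lt loss_level good0 (lexx _) c_near A0 phi_ge0 phi_bd).
- exact: (climb_integral unif cP (loss_good unif) loss_cost_sum cost_ge1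
    loss_level good0 (lexx _) c_near A0 phi_ge0 phi_bd).
Qed.

End Realization.

(** * Inductive choice of the parameters in a flexible class *)

Lemma infinite_set_ge (A : set nat) N : infinite_set A -> exists2 n, A n & (N
  <= n)%N.
Proof.
move=> Ai; apply: contrapT => no; apply: Ai.
apply: (sub_finite_set _ (finite_II N)) => n An /=.
by rewrite ltnNge; apply/negP => Nn; apply: no; exists n.
Qed.

Lemma height_eq (u v : nat -> csparam) n :
  (forall i, (i < n)%N -> u i = v i) -> height u n = height v n.
Proof.
elim: n => // n IH uv /=; rewrite uv // IH // => i ni.
by apply: uv; exact: leqW.
Qed.

Theorem theorem2 (R : realType) (phi : R -> R)
    (phi_ge0 : forall t : R, 0 <= t -> 0 <= phi t)
    (phi_o : phi =o_ (pinfty_nbhs R) (fun t : R => t `^ (3%:R^-1)))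
    (C : system R -> Prop) (C_rank_one : rank_one_class C)
    (C_flexible : flexible C) :
  exists T : system R, C T /\
    exists U : system R, universal_odometer U /\
      integrably_orbit_equivalent phi T U.
Proof.
have [F [[K K0 FC] [p0 [Fp0 p03]] [K' K'0 Fnext]]] := C_flexible.
pose L := (Num.truncn K').+1.
pose good_next s p := F s -> (1 <= size s)%N ->
  [/\ F (rcons s p), (cut_threshold L (size s).+1 (seq_height s (size s)) <=
    cuts p)%N &
      (spacer_sum p <= L * cuts p * seq_height s (size s).-1)%N].
have [next nextP] : {next & forall s, good_next s (next s)}.
  apply: choice => s; have [Fs|nF] := pselect (F s /\ (1 <= size s)%N); last first.
    by exists csparam0 => Fs s1; case: nF.
  have [q [p [pq Fp sp]] qN] := infinite_set_ge
    (cut_threshold L (size s).+1 (seq_height s (size s))) (Fnext s Fs.2 Fs.1).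
  exists p => _ _; split=> //; first by rewrite pq.
  rewrite -(ler_nat R); apply: le_trans sp _.
  rewrite !natrM pq !ler_wpM2r //; apply: ltW; exact: truncnS_gt.
(* A chain of sequences in [F] starting from [p0]; each extension picks, among the infinitely many
   admissible numbers of cuts, one above the threshold. The sequence [w] is its limit. *)
pose sq n := iter n (fun s => rcons s (next s)) [:: p0].
have size_sq n : size (sq n) = n.+1 by elim: n => // n IH;
  rewrite /sq iterS size_rcons IH.
have sq_gt0 n : (1 <= size (sq n))%N by rewrite size_sq.
have Fsq n : F (sq n).
  by elim: n => // n IH; have [] := nextP _ IH (sq_gt0 n).
pose w n := nth csparam0 (sq n) n.
have nth_sq n i : (i <= n)%N -> nth csparam0 (sq n) i = w i.
  move=> /subnKC <-; elim: (n - i)%N => [|d IH]; first by rewrite addn0.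
  by rewrite addnS {1}/sq iterS -/(sq _) nth_rcons size_sq ltnS leq_addr.
have wS n : w n.+1 = next (sq n).
  by rewrite /w {1}/sq iterS -/(sq _) nth_rcons size_sq ltnn eqxx.
have height_sq n k : (k <= n.+1)%N -> seq_height (sq n) k = height w k.
  by move=> kn; apply: height_eq => i ik; apply: nth_sq;
    rewrite -ltnS (leq_trans ik).
have wF n : F (mkseq w n.+1).
  rewrite (_ : mkseq w n.+1 = sq n) //; apply: (@eq_from_nth _ csparam0).
    by rewrite size_mkseq size_sq.
  by move=> i; rewrite size_mkseq => ilt; rewrite nth_mkseq // nth_sq.
have w_cuts n : (0 < n)%N -> (cut_threshold L n.+1 (height w n) <= cuts (w n))%N.
  case: n => // n _; rewrite wS; have [_ + _] := nextP _ (Fsq n) (sq_gt0 n).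
  by rewrite size_sq height_sq.
have w_spacers n : (0 < n)%N ->
    (spacer_sum (w n) <= L * cuts (w n) * height w n.-1)%N.
  case: n => // n _; rewrite wS; have [_ _] := nextP _ (Fsq n) (sq_gt0 n).
  by rewrite size_sq height_sq.
(* Condition (F) must be known before the first condition on flexible classes places every system
   constructed from [w] in [C]. *)
have [_ CT] := FC w (small_spacers R p03 w_cuts w_spacers) wF.
have [T [cT [U UT]]] := realization p03 w_cuts w_spacers phi_ge0 phi_o.
by exists T; split; [exact: CT | exists U].
Qed.
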